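(* Let $X$ be a second countable locally compact Hausdorff space and let $A$ and $B$ be $C_0(X)$-algebras. Then an asymptotic morphism from $A$ to $B$ is asymptotically $C_0(X)$-equivariant if and only if it is approximately $X$-equivariant.
   Context: A $C_0(X)$-algebra is a $C^*$-algebra $A$ with a nondegenerate $*$-homomorphism from $C_0(X)$ to the centre of the multiplier algebra of $A$ ($C_0(X)A$ dense in $A$). For $U\subseteq X$ open put $A(U)=C_0(U)A$ (a closed ideal), for $S\subseteq X$ closed put $A(S)=A/A(X\setminus S)$, and let $\|a\|_S$ be the norm of the image of $a\in A$ in $A(S)$. Put $T=[0,\infty)$. An asymptotic morphism from $A$ to $B$ is a map $\varphi\colon A\to C_b(T,B)$, $a\mapsto(t\mapsto\varphi_t(a))$, that induces a $*$-homomorphism $A\to C_b(T,B)/C_0(T,B)$. It is approximately $X$-equivariant if $\lim_{t\to\infty}\|\varphi_t(a)\|_{X\setminus U}=0$ for every open $U\subseteq X$ and all $a\in A(U)$. It is asymptotically $C_0(X)$-equivariant if $\varphi(fa)-f\varphi(a)\in C_0(T,B)$ for all $a\in A$ and $f\in C_0(X)$. *)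

(* Defs.v *)
From HB Require Import structures.
From mathcomp Require Import all_boot all_order all_algebra.
From mathcomp Require Import complex.
From mathcomp Require Import all_classical all_reals all_analysis.

Set Implicit Arguments.
Unset Strict Implicit.
Unset Printing Implicit Defensive.

Import Order.TTheory GRing.Theory Num.Theory numFieldNormedType.Exports.

Local Open Scope classical_set_scope.
Local Open Scope ring_scope.

                                                                               
                                
HB.mixin Record CompleteNormedModule_isCStarAlgebra (R : realType) A
    of CompleteNormedModule R[i] A := {
  cmul : A -> A -> A;
  cstar : A -> A;
  cmulA : associative cmul;
  cmulDl : left_distributive cmul +%R;
  cmulDr : right_distributive cmul +%R;
  cscalerAl : forall (z : R[i]) (a b : A), z *: cmul a b = cmul (z *: a) b;
  cscalerAr : forall (z : R[i]) (a b : A), z *: cmul a b = cmul a (z *: b);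
  cstarK : involutive cstar;
  cstarD : {morph cstar : a b / a + b};
  cstarZ : forall (z : R[i]) (a : A), cstar (z *: a) = z^* *: cstar a;
  cstarM : forall a b : A, cstar (cmul a b) = cmul (cstar b) (cstar a);
  normr_cmul_le : forall a b : A, `|cmul a b| <= `|a| * `|b|;
  normr_cstar_cmul : forall a : A, `|cmul (cstar a) a| = `|a| ^+ 2
}.

#[short(type="cstarAlgType")]
HB.structure Definition CStarAlgebra (R : realType) :=
  {A of CompleteNormedModule_isCStarAlgebra R A & CompleteNormedModule R[i] A}.

Arguments cmul {R s} a b.
Arguments cstar {R s} a.

Section ContinuousFunctions.
Variables (R : realType) (X : topologicalType).

                                                                         
             
Definition C0 : set (X -> R[i]^o) :=
  [set f | continuous f /\
           forall e : R[i], 0 < e -> compact [set x | e <= `|f x|]].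

                                                                 
Definition C0_open (U : set X) : set (X -> R[i]^o) :=
  [set f | C0 f /\ forall x, ~ U x -> f x = 0].

Definition C0_conj (f : X -> R[i]^o) : X -> R[i]^o := fun x => (f x)^*.

End ContinuousFunctions.

                                                                        
                               
Section FunctionsOnHalfLine.
Variables (R : realType) (B : cstarAlgType R).

Definition CbT : set (R -> B) :=
  [set g : R -> B | {within `[0, +oo[, continuous g} /\
           [bounded g t | t in `[0, +oo[]].

Definition C0T : set (R -> B) :=
  [set g : R -> B | {within `[0, +oo[, continuous g} /\ g t @[t --> +oo] --> (0 : B)].

End FunctionsOnHalfLine.

                                                                               
                                                                                
                             
Section Multipliers.
Variables (R : realType) (A : cstarAlgType R).

Definition bounded_linear (L : A -> A) : Prop :=
  linear L /\ exists M : R[i], forall a, `|L a| <= M * `|a|.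

Definition multiplier : set ((A -> A) * (A -> A)) :=
  [set m | [/\ bounded_linear m.1, bounded_linear m.2,
               forall a b, m.1 (cmul a b) = cmul (m.1 a) b,
               forall a b, m.2 (cmul a b) = cmul a (m.2 b) &
               forall a b, cmul a (m.1 b) = cmul (m.2 a) b]].

Definition mult_mul (m n : (A -> A) * (A -> A)) : (A -> A) * (A -> A) :=
  (m.1 \o n.1, n.2 \o m.2).

Definition mult_star (m : (A -> A) * (A -> A)) : (A -> A) * (A -> A) :=
  (fun b => cstar (m.2 (cstar b)), fun b => cstar (m.1 (cstar b))).

Definition mult_center : set ((A -> A) * (A -> A)) :=
  [set m | multiplier m /\
           forall n, multiplier n -> mult_mul m n = mult_mul n m].

End Multipliers.

Section C0Structure.
Variables (R : realType) (X : topologicalType) (A : cstarAlgType R).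
Variable theta : (X -> R[i]^o) -> (A -> A) * (A -> A).

                                                                          
                                       
Definition C0_prod (U : set X) : set A :=
  [set b | exists f a, C0_open U f /\ b = (theta f).1 a].

                                                
Record is_C0_structure : Prop := {
  C0_structure_center : forall f, C0 f -> mult_center (theta f);
  C0_structureD :
    forall f g, C0 f -> C0 g -> theta (f + g) = theta f + theta g;
  C0_structureZ :
    forall (z : R[i]) f, C0 f -> theta (z *: f) = z *: theta f;
  C0_structureM :
    forall f g, C0 f -> C0 g -> theta (f * g) = mult_mul (theta f) (theta g);
  C0_structure_star :
    forall f, C0 f -> theta (C0_conj f) = mult_star (theta f);
  C0_structure_nondegenerate : dense (C0_prod setT)
}.

End C0Structure.

Record C0_algebra (R : realType) (X : topologicalType) := C0Algebra {
  C0_algebra_sort :> cstarAlgType R;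
  C0_structure : (X -> R[i]^o) -> (C0_algebra_sort -> C0_algebra_sort) *
                                  (C0_algebra_sort -> C0_algebra_sort);
  C0_structureP : is_C0_structure C0_structure
}.

Section C0AlgebraTheory.
Variables (R : realType) (X : topologicalType) (A : C0_algebra R X).

Definition C0_act (f : X -> R[i]^o) (a : A) : A := (C0_structure A f).1 a.

          
Definition C0_ideal (U : set X) : set A := C0_prod (C0_structure A) U.

                                                       
Definition norm_on (S : set X) (a : A) : R :=
  inf [set complex.Re `|a + b| | b in C0_ideal (~` S)].

End C0AlgebraTheory.

                                                          
Record asymptotic_morphism (R : realType) (A B : cstarAlgType R)
    (phi : A -> R -> B) : Prop := {
  asymptotic_Cb : forall a, CbT (phi a);
  asymptoticD : forall a b, C0T (phi (a + b) - (phi a + phi b));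
  asymptoticZ : forall (z : R[i]) a, C0T (phi (z *: a) - z *: phi a);
  asymptoticM :
    forall a b, C0T (phi (cmul a b) - (fun t => cmul (phi a t) (phi b t)));
  asymptotic_star : forall a, C0T (phi (cstar a) - (fun t => cstar (phi a t)))
}.

Section Equivariance.
Variables (R : realType) (X : topologicalType) (A B : C0_algebra R X).

Definition approximately_equivariant (phi : A -> R -> B) : Prop :=
  forall U : set X, open U -> forall a : A, C0_ideal U a ->
    norm_on (~` U) (phi a t) @[t --> +oo] --> (0 : R).

Definition asymptotically_C0_equivariant (phi : A -> R -> B) : Prop :=
  forall (a : A) (f : X -> R[i]^o), C0 f ->
    C0T (phi (C0_act f a) - (fun t => C0_act f (phi a t))).

End Equivariance.

(* Main.v *)
Require Import Defs.
From HB Require Import structures.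
From mathcomp Require Import all_boot all_order all_algebra.
From mathcomp Require Import complex.
From mathcomp Require Import all_classical all_reals all_analysis.
From mathcomp Require Import ring lra zify.

Import Order.TTheory GRing.Theory Num.Theory numFieldNormedType.Exports.

Local Open Scope classical_set_scope.
Local Open Scope ring_scope.

Set Implicit Arguments.
Unset Strict Implicit.
Unset Printing Implicit Defensive.

Local Open Scope complex_scope.

(** The implication from asymptotic C_0(X)-equivariance is immediate: for
    [a = f a'] with [f] in C_0(U), the element [phi_t a] is close to
    [f (phi_t a')], which lies in C_0(U)B, so its norm in the quotient over the
    complement of [U] is small ([approximately_of_asymptotically]).

    For the converse, fix a real [f] in C_0(X) and cut an element [a] along the
    values of [f].  Hat functions [F_k] of support radius [1/n], centred at nodes
    [l_k] with spacing [1/n], form a partition of unity on the range of [f].  The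
    pieces [a_k = F_k(f) a] lie in C_0(U_k)A, where [U_k] is the open set on
    which [f] is within [1/n] of [l_k], and they add up to [a].  On the side of
    [A], [f a] differs from the sum of the [l_k a_k] by [G(f) a] for a function
    [G] bounded by [1/n], so [phi_t (f a)] is close to the sum of the
    [l_k phi_t(a_k)].  On the side of [B], approximate equivariance puts each
    [phi_t(a_k)] close to C_0(U_k)B, where [f - l_k] has norm at most [1/n].
    There are about [n] error terms [(f - l_k) phi_t(a_k)], each of size [1/n],
    and the triangle inequality alone would give no decay.  But terms with
    distant indices live on disjoint open sets and are orthogonal, so the
    squared norm of their sum is bounded by a constant times [n (1/n)^2]
    ([rnorm_sum_almost_orthogonal]); hence the defect
    [phi_t(f a) - f (phi_t a)] tends to [0].

    Some hats do not vanish at [0], and then [F_k(f)] need not be in C_0(X).  The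
    pieces are therefore formed for [a = h a'] with [h] in C_0(X), where
    [F_k(f) h] is in C_0(U_k).  Such [a] are dense by nondegeneracy, and the
    asymptotic contractivity of [phi] extends the estimate to all of [A].

    The estimates on norms all come from one rotation argument
    ([seminorm_pythagoras]).  Let [L] be a seminorm with the C*-identity.  If
    [x*x + y*y = a*a] and [x*y = y*x], then [x + iy] and [x - iy] have the same
    modulus as [a], hence the same [L], and averaging gives [L x <= L a].  With
    [x = F(f) a] and [y = sqrt(1 - F^2)(f) a] this shows that a function bounded
    by [1] acts contractively for [L] ([seminorm_fcalc_le]), and a square root
    of [1 - a^2] for self-adjoint [a] of norm below [1] gives that [L] is
    dominated by the norm ([seminorm_le_rnorm]).  The first is used for the norm
    of [B] and for the seminorm [limsup_t |phi_t a|] ([asymptotic_seminorm]) on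
    [A]; the second is the asymptotic contractivity of [phi]. *)

(** * Real-valued norms *)
Section RealNorm.
Variables (R : realType).

Lemma normc_real (x : R) : `|x%:C| = `|x|%:C.
Proof. by rewrite normc_def /= expr0n addr0 sqrtr_sqr. Qed.

Lemma conjC_realC (x : R) : (x%:C)^*%R = x%:C.
Proof. exact: conjc_real. Qed.

Lemma normc_RRe (z : R[i]) : 0 <= z -> z = (complex.Re z)%:C.
Proof. by move=> z0; rewrite RRe_real // ger0_real. Qed.

Variable V : normedModType R[i].
Implicit Types u v : V.

(** The norm of a complex normed module takes values in [R[i]], which is only
    partially ordered; estimates are carried out with its real part. *)
Definition rnorm v : R := complex.Re `|v|.

Lemma rnormE v : `|v| = (rnorm v)%:C.
Proof. exact: normc_RRe. Qed.

Lemma rnorm_ge0 v : 0 <= rnorm v.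
Proof. by rewrite -lecR -rnormE normr_ge0. Qed.

Lemma rnorm0 : rnorm 0 = 0.
Proof. by rewrite /rnorm normr0. Qed.

Lemma rnorm0_eq0 v : rnorm v = 0 -> v = 0.
Proof. by move=> v0; apply/eqP; rewrite -normr_eq0 rnormE v0. Qed.

Lemma rnormD u v : rnorm (u + v) <= rnorm u + rnorm v.
Proof. by rewrite -lecR rmorphD /= -!rnormE ler_normD. Qed.

Lemma rnormN v : rnorm (- v) = rnorm v.
Proof. by rewrite /rnorm normrN. Qed.

Lemma rnormB u v : rnorm (u - v) <= rnorm u + rnorm v.
Proof. by rewrite -(rnormN v) rnormD. Qed.

Lemma rdistC u v : rnorm (u - v) = rnorm (v - u).
Proof. by rewrite -rnormN opprB. Qed.

Lemma rnormZ (z : R[i]) v : rnorm (z *: v) = complex.Re `|z| * rnorm v.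
Proof.
apply: complexI; rewrite rmorphM /= -!rnormE normrZ.
by congr (_ * _); apply: normc_RRe.
Qed.

Lemma rnormZr (x : R) v : rnorm (x%:C *: v) = `|x| * rnorm v.
Proof. by rewrite rnormZ normc_real. Qed.

Lemma rnorm_sum (I : Type) (r : seq I) (P : pred I) (f : I -> V) :
  rnorm (\sum_(i <- r | P i) f i) <= \sum_(i <- r | P i) rnorm (f i).
Proof.
elim/big_ind2: _ => [|x1 x2 y1 y2 h1 h2|//]; first by rewrite rnorm0.
by apply: le_trans (rnormD _ _) _; apply: lerD.
Qed.

Lemma cvg0_rnormP {T : Type} (F : set_system T) {FF : Filter F} (g : T -> V) :
  g x @[x --> F] --> (0 : V) <->
  forall e : R, 0 < e -> \forall x \near F, rnorm (g x) < e.
Proof.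
split=> [/cvgr0Pnorm_lt g0 e e0|g0].
  have e0' : 0 < e%:C by rewrite ltcR.
  apply: filterS (g0 _ e0') => x /=.
  by rewrite rnormE ltcR.
apply/cvgr0Pnorm_lt => e e0.
have eE := normc_RRe (ltW e0).
have e0' : 0 < complex.Re e by rewrite -ltcR -eE.
apply: filterS (g0 _ e0') => x /=.
by rewrite -ltcR -eE -rnormE.
Qed.

Lemma cvg_rnormP {T : Type} (F : set_system T) {FF : Filter F} (g : T -> V) l :
  g x @[x --> F] --> l <->
  forall e : R, 0 < e -> \forall x \near F, rnorm (g x - l) < e.
Proof.
by rewrite -cvg0_rnormP; split=> /subr_cvg0.
Qed.

End RealNorm.
Arguments rnorm {R V} v.

(** * Algebra in a C*-algebra *)
Section CStar.
Variables (R : realType) (A : cstarAlgType R).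
Implicit Types a b c : A.

Lemma cmulZl (z : R[i]) a b : cmul (z *: a) b = z *: cmul a b.
Proof. by rewrite cscalerAl. Qed.

Lemma cmulZr (z : R[i]) a b : cmul a (z *: b) = z *: cmul a b.
Proof. by rewrite cscalerAr. Qed.

Lemma cmul0r a : cmul 0 a = 0.
Proof. by rewrite -(scale0r (0 : A)) cmulZl !scale0r. Qed.

Lemma cmulr0 a : cmul a 0 = 0.
Proof. by rewrite -(scale0r (0 : A)) cmulZr !scale0r. Qed.

Lemma cmulNr a b : cmul (- a) b = - cmul a b.
Proof. by rewrite -scaleN1r cmulZl scaleN1r. Qed.

Lemma cmulrN a b : cmul a (- b) = - cmul a b.
Proof. by rewrite -scaleN1r cmulZr scaleN1r. Qed.

Lemma cmulBl a b c : cmul (a - b) c = cmul a c - cmul b c.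
Proof. by rewrite cmulDl cmulNr. Qed.

Lemma cmulBr a b c : cmul a (b - c) = cmul a b - cmul a c.
Proof. by rewrite cmulDr cmulrN. Qed.

Lemma cmul_suml (I : Type) (r : seq I) (P : pred I) (f : I -> A) b :
  cmul (\sum_(i <- r | P i) f i) b = \sum_(i <- r | P i) cmul (f i) b.
Proof.
by apply: (big_morph (cmul ^~ b)) => [x y|]; rewrite /= ?cmulDl ?cmul0r.
Qed.

Lemma cmul_sumr (I : Type) (r : seq I) (P : pred I) (f : I -> A) b :
  cmul b (\sum_(i <- r | P i) f i) = \sum_(i <- r | P i) cmul b (f i).
Proof.
by apply: (big_morph (cmul b)) => [x y|]; rewrite /= ?cmulDr ?cmulr0.
Qed.

Lemma cstar0 : cstar (0 : A) = 0.
Proof. by rewrite -(scale0r (0 : A)) cstarZ conjC0 !scale0r. Qed.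

Lemma cstarN a : cstar (- a) = - cstar a.
Proof. by rewrite -scaleN1r cstarZ conjCN1 scaleN1r. Qed.

Lemma cstarB a b : cstar (a - b) = cstar a - cstar b.
Proof. by rewrite cstarD cstarN. Qed.

Lemma cstar_sum (I : Type) (r : seq I) (P : pred I) (f : I -> A) :
  cstar (\sum_(i <- r | P i) f i) = \sum_(i <- r | P i) cstar (f i).
Proof. by apply: big_morph; [exact: cstarD | exact: cstar0]. Qed.

Lemma rnorm_cmul a b : rnorm (cmul a b) <= rnorm a * rnorm b.
Proof. by rewrite -lecR rmorphM /= -!rnormE normr_cmul_le. Qed.

Lemma rnorm_cstar_cmul a : rnorm (cmul (cstar a) a) = rnorm a ^+ 2.
Proof. by apply: complexI; rewrite rmorphXn /= -!rnormE normr_cstar_cmul. Qed.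

Lemma rnorm_cstar a : rnorm (cstar a) = rnorm a.
Proof.
have le b : rnorm b <= rnorm (cstar b).
  have := rnorm_cmul (cstar b) b; rewrite rnorm_cstar_cmul expr2.
  have [->|b0] := eqVneq (rnorm b) 0; first by rewrite rnorm_ge0.
  by rewrite ler_pM2r // lt_def b0 rnorm_ge0.
by apply/eqP; rewrite eq_le le andbT -{2}(cstarK a) le.
Qed.

End CStar.

(** * C*-seminorms and the rotation argument *)

Record cstar_seminorm (R : realType) (A : cstarAlgType R) (L : A -> R) : Prop := {
  seminormD : forall a b, L (a + b) <= L a + L b;
  seminormZ : forall (z : R[i]) a, L (z *: a) = complex.Re `|z| * L a;
  seminorm_cstar_cmul : forall a, L (cmul (cstar a) a) = L a ^+ 2
}.

Section Seminorm.
Variables (R : realType) (A : cstarAlgType R) (L : A -> R).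
Hypothesis L_sn : cstar_seminorm L.
Implicit Types a b x y k : A.

Lemma seminormZr (c : R) a : L (c%:C *: a) = `|c| * L a.
Proof. by rewrite (seminormZ L_sn) normc_real. Qed.

Lemma seminorm0 : L 0 = 0.
Proof. by rewrite -(scale0r (0 : A)) (seminormZ L_sn) normr0 mul0r. Qed.

Lemma seminormN a : L (- a) = L a.
Proof. by rewrite -scaleN1r (seminormZ L_sn) normrN normr1 mul1r. Qed.

Lemma seminorm_ge0 a : 0 <= L a.
Proof.
have := seminormD L_sn a (- a).
by rewrite subrr seminorm0 seminormN -mulr2n pmulrn_lge0.
Qed.

Lemma seminorm_sqr_inj a b : L a ^+ 2 = L b ^+ 2 -> L a = L b.
Proof.
by move=> /eqP; rewrite eqrXn2 ?seminorm_ge0// => /eqP.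
Qed.

(** The elements [x + w y] with [w = i] and [w = -i] satisfy
    [(x + w y)*(x + w y) = a*a], because the cross terms cancel, so the
    C*-identity gives them the same seminorm as [a]; and [x] is their mean. *)
Lemma seminorm_pythagoras a x y :
  cmul (cstar x) x + cmul (cstar y) y = cmul (cstar a) a ->
  cmul (cstar x) y = cmul (cstar y) x ->
  L x <= L a.
Proof.
move=> sum_sqr comm_xy.
have rotation (w : R[i]) : w^*%R = - w -> w * w = -1 -> L (x + w *: y) = L a.
  move=> wJ ww; apply: seminorm_sqr_inj; rewrite -!(seminorm_cstar_cmul L_sn).
  congr L; rewrite -sum_sqr cstarD cstarZ wJ !(cmulDl, cmulDr).
  rewrite !(cmulZl, cmulZr) !scalerA mulrN ww opprK scale1r comm_xy scaleNr.
  by rewrite addrA addrK.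
have iJ : ('i : R[i])^*%R = - 'i by exact: conjCi.
have i2 : ('i : R[i]) * 'i = -1 by rewrite -expr2 sqrCi.
have -> : x = (2^-1 : R)%:C *: ((x + 'i%C *: y) + (x + (- 'i%C) *: y)).
  rewrite scaleNr addrACA subrr addr0 -mulr2n -(scaler_nat 2 x) scalerA.
  have -> : 2 = (2 : R)%:C :> R[i] by rewrite rmorph_nat.
  by rewrite -rmorphM /= mulVf ?pnatr_eq0// scale1r.
rewrite seminormZr ger0_norm ?invr_ge0// ler_pdivrMl// mulr_natl mulr2n.
apply: le_trans (seminormD L_sn _ _) _.
by rewrite !rotation ?mulrNN ?i2 ?rmorphN /= ?iJ.
Qed.

End Seminorm.

Lemma rnorm_seminorm (R : realType) (A : cstarAlgType R) :
  cstar_seminorm (rnorm : A -> R).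
Proof. by split; [exact: rnormD | exact: rnormZ | exact: rnorm_cstar_cmul]. Qed.

Section SquareRoot.
Variables (R : realType) (A : cstarAlgType R) (a : A).
Hypotheses (a_sa : cstar a = a) (a_lt1 : rnorm a < 1).

Let q := rnorm a ^+ 2.
Let r := (1 + q) / 2.
Let step (k : A) := (2^-1 : R)%:C *: (cmul a a + cmul k k).
Let iterate n := iter n step 0.

Let q_lt1 : q < 1.
Proof. by rewrite /q exprn_ilt1// rnorm_ge0. Qed.

Let r_ge0 : 0 <= r.
Proof. by rewrite /r divr_ge0// addr_ge0// sqr_ge0. Qed.

Let r_lt1 : r < 1.
Proof. by rewrite /r; move: q_lt1; lra. Qed.

Let half_norm (x : A) : rnorm ((2^-1 : R)%:C *: x) = rnorm x / 2.
Proof. by rewrite rnormZr ger0_norm ?invr_ge0// mulrC. Qed.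

Let step_ball k : rnorm k <= r -> rnorm (step k) <= r.
Proof.
move=> kr; rewrite half_norm ler_pdivrMr//.
apply: le_trans (rnormD _ _) _.
have := rnorm_cmul a a; rewrite -expr2 -/q.
have : rnorm (cmul k k) <= r * r.
  by apply: le_trans (rnorm_cmul k k) _; apply: ler_pM; rewrite ?rnorm_ge0.
have : r * r <= r by rewrite -[leRHS]mulr1 ler_wpM2l// ltW.
move: q_lt1; rewrite /r; lra.
Qed.

Let step_lipschitz k l : rnorm k <= r -> rnorm l <= r ->
  rnorm (step k - step l) <= r * rnorm (k - l).
Proof.
move=> kr lr; rewrite -scalerBr half_norm ler_pdivrMr//.
have -> : cmul a a + cmul k k - (cmul a a + cmul l l) =
          cmul k (k - l) + cmul (k - l) l.
  by rewrite opprD addrACA subrr add0r cmulBr cmulBl addrA subrK.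
apply: le_trans (rnormD _ _) _; rewrite mulr_natr mulr2n.
apply: lerD; apply: le_trans (rnorm_cmul _ _) _.
  by rewrite ler_wpM2r ?rnorm_ge0.
by rewrite mulrC ler_wpM2r ?rnorm_ge0.
Qed.

Let iterate_ball n : rnorm (iterate n) <= r.
Proof. by elim: n => [|n IHn]; [rewrite rnorm0 | exact: step_ball]. Qed.

(** Shifting the iterates [p] and [0] by the same [n] steps multiplies their
    distance by at most [r ^+ n], so no geometric series has to be summed. *)
Let iterate_cauchy n p : rnorm (iterate (n + p)%N - iterate n) <= r ^+ n.
Proof.
elim: n => [|n IHn].
  by rewrite add0n subr0 (le_trans (iterate_ball p))// expr0 ltW.
rewrite addSn exprS; apply: le_trans (step_lipschitz _ _) _ => //.
by rewrite ler_wpM2l.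
Qed.

Let iterate_cvg : cvg (iterate n @[n --> \oo]).
Proof.
apply/cauchy_cvgP/cauchy_exP => e e0.
have e_real := normc_RRe (ltW e0).
have /cvgrPdist_lt/(_ (complex.Re e)) : r ^+ n @[n --> \oo] --> 0.
  by apply: cvg_expr; rewrite ger0_norm.
rewrite -ltcR -e_real => /(_ e0) [N _ /(_ N (leqnn N))].
rewrite sub0r normrN ger0_norm ?exprn_ge0// => rN.
exists (iterate N); exists N => // n /= Nn.
rewrite -ball_normE /= rnormE e_real ltcR rdistC -(subnKC Nn).
exact: le_lt_trans (iterate_cauchy _ _) rN.
Qed.

(** Formally [k = 1 - sqrt (1 - a^2)], so that [(1 - k)^2 = 1 - a^2]; this
    reads [k = (a^2 + k^2) / 2].  As [|a| < 1], the right hand side is a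
    contraction of the ball of radius [r = (1 + |a|^2) / 2 < 1], and [k] is the
    limit of its iterates from [0], which are self-adjoint and commute
    with [a]. *)
Lemma one_sub_sqrt_one_sub_sqr_exists :
  exists k : A, [/\ cstar k = k, cmul a k = cmul k a &
                    k + k = cmul a a + cmul k k].
Proof.
pose k := lim (iterate n @[n --> \oo]); exists k.
have /cvg_rnormP k_lim : iterate n @[n --> \oo] --> k by exact: iterate_cvg.
have small (x : A) : (forall n e, rnorm (iterate n - k) < e ->
    rnorm (iterate n.+1 - k) < e -> rnorm x <= 2 * e) -> x = 0.
  move=> x_small; apply: rnorm0_eq0; apply/eqP; rewrite eq_le rnorm_ge0 andbT.
  apply/ler_addgt0Pr => e e0; rewrite add0r.
  have e20 : 0 < e / 2 by rewrite divr_gt0.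
  have [N _ kN] := k_lim _ e20.
  rewrite -[e](divfK (_ : 2 != 0)) ?pnatr_eq0// [_ * 2]mulrC.
  by apply: (x_small N); apply: kN => /=.
have k_ball : rnorm k <= r.
  apply/ler_addgt0Pr => e e0; have [N _ /(_ N (leqnn N)) /= kN] := k_lim e e0.
  rewrite -[k](subKr (iterate N)); apply: le_trans (rnormB _ _) _.
  by rewrite lerD// ltW.
have iter_star n : cstar (iterate n) = iterate n.
  elim: n => [|n IHn]; first exact: cstar0.
  by rewrite /= /step cstarZ cstarD !cstarM a_sa IHn conjC_realC.
have iter_comm n : cmul a (iterate n) = cmul (iterate n) a.
  elim: n => [|n IHn]; first by rewrite cmulr0 cmul0r.
  rewrite -[iterate n.+1]/(step (iterate n)) /step; set j := iterate n in IHn *.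
  by rewrite cmulZl cmulZr cmulDl cmulDr !cmulA IHn -(cmulA j a j) IHn cmulA.
split.
- apply/eqP; rewrite -subr_eq0; apply/eqP/small => n e kn _.
  rewrite -[k in cstar k](subKr (iterate n)) cstarB iter_star.
  rewrite addrAC; apply: le_trans (rnormB _ _) _.
  by rewrite rnorm_cstar mulr_natl mulr2n lerD// ltW.
- apply/eqP; rewrite -subr_eq0; apply/eqP/small => n e kn _.
  have -> : cmul a k - cmul k a =
            cmul (iterate n - k) a - cmul a (iterate n - k).
    by rewrite cmulBr cmulBl iter_comm opprB [RHS]addrC addrA subrK.
  apply: le_trans (rnormB _ _) _.
  have le_e : rnorm (iterate n - k) * rnorm a <= e.
    apply: le_trans (ltW kn); rewrite -[leRHS]mulr1 ler_wpM2l ?rnorm_ge0//.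
    exact: ltW.
  rewrite mulr_natl mulr2n lerD//; apply: le_trans (rnorm_cmul _ _) _ => //.
  by rewrite mulrC.
- have -> : k + k = (2 : R)%:C *: k by rewrite rmorph_nat scaler_nat mulr2n.
  apply/eqP; rewrite -subr_eq0; apply/eqP.
  have -> : cmul a a + cmul k k = (2 : R)%:C *: step k.
    by rewrite scalerA -rmorphM /= divff ?pnatr_eq0// scale1r.
  rewrite -scalerBr (small (k - step k)) ?scaler0// => n e kn kn1.
  have -> : k - step k = (k - iterate n.+1) + (iterate n.+1 - step k).
    by rewrite addrA subrK.
  apply: le_trans (rnormD _ _) _; rewrite mulr_natl mulr2n addrC lerD//.
    apply: le_trans (step_lipschitz (iterate_ball n) k_ball) _.
    apply: le_trans (ltW kn); rewrite -[leRHS]mul1r ler_wpM2r ?rnorm_ge0//.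
    exact: ltW.
  by rewrite rdistC ltW.
Qed.

End SquareRoot.
Section Contractive.
Variables (R : realType) (A : cstarAlgType R) (L : A -> R).
Hypothesis L_sn : cstar_seminorm L.

(** With [k = 1 - sqrt(1 - a^2)], the rotation argument applied to [x = a^2]
    and [y = sqrt(1 - a^2) a = a - k a] gives [L (a^2) <= L a].  The
    C*-identity turns this into [(L a)^2 <= L a]. *)
Lemma seminorm_selfadjoint_le1 (a : A) :
  cstar a = a -> rnorm a < 1 -> L a <= 1.
Proof.
move=> a_sa a_lt1.
have [k [k_sa ak k_eq]] := one_sub_sqrt_one_sub_sqr_exists a_sa a_lt1.
have sqr_le : L (cmul a a) <= L a.
  apply: (seminorm_pythagoras L_sn (y := a - cmul k a)).
    rewrite cstarB !cstarM a_sa k_sa cmulBl !cmulBr.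
    have -> : cmul (cmul a k) (cmul k a) =
              cmul (cmul a (k + k - cmul a a)) a.
      by rewrite k_eq addrC addKr -!cmulA.
    rewrite cmulBr cmulBl cmulDr cmulDl !cmulA.
    set s := cmul (cmul a k) a.
    rewrite -(addrA s s) (opprD s (s - _)) (addrA s) subrr add0r opprK.
    by rewrite (addrA (_ - s)) (subrK s) addrCA subrr addr0.
  rewrite cstarB !cstarM a_sa k_sa cmulBl !cmulBr !cmulA.
  by congr (_ - _); rewrite -(cmulA a a k) [in LHS]ak !cmulA.
rewrite leNgt; apply/negP => La_gt1.
have := seminorm_cstar_cmul L_sn a; rewrite a_sa => sqrE.
move: sqr_le; rewrite sqrE expr2 leNgt => /negP; apply.
by rewrite -[ltLHS]mulr1 ltr_pM2l// (lt_trans ltr01).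
Qed.

(** Applied to the limit superior seminorm, this is the automatic
    contractivity of the *-homomorphism that [phi] induces.  It follows from the
    self-adjoint case because both sides satisfy the C*-identity. *)
Lemma seminorm_le_rnorm (a : A) : L a <= rnorm a.
Proof.
have sa (b : A) : cstar b = b -> L b <= rnorm b.
  move=> b_sa; apply/ler_addgt0Pr => e e0.
  have c0 : 0 < rnorm b + e by rewrite ltr_wpDl// rnorm_ge0.
  have := @seminorm_selfadjoint_le1 (((rnorm b + e)^-1)%:C *: b).
  rewrite cstarZ conjC_realC b_sa rnormZr (seminormZr L_sn).
  rewrite ger0_norm ?invr_ge0 ?(ltW c0)// !ler_pdivrMl// ltr_pdivrMl// !mulr1.
  by apply=> //; rewrite ltrDl.
rewrite -(@ler_pXn2r _ 2)// ?nnegrE ?(seminorm_ge0 L_sn) ?rnorm_ge0//.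
rewrite -(seminorm_cstar_cmul L_sn) -rnorm_cstar_cmul sa//.
by rewrite cstarM cstarK.
Qed.

End Contractive.

(** * Functions vanishing at infinity *)
Section C0Functions.
Variables (R : realType) (X : topologicalType).
Implicit Types f g : X -> R[i]^o.

Lemma rnormM (z w : R[i]) :
  rnorm (z * w : R[i]^o) = rnorm (z : R[i]^o) * rnorm (w : R[i]^o).
Proof. by rewrite -[z * w]/(z *: (w : R[i]^o)) rnormZ. Qed.

Lemma rnorm_realC (c : R) : rnorm (c%:C : R[i]^o) = `|c|.
Proof. by rewrite /rnorm normc_real. Qed.

Lemma rnorm_conjC (z : R[i]) : rnorm (z^*%R : R[i]^o) = rnorm (z : R[i]^o).
Proof. by rewrite /rnorm norm_conjC. Qed.

Lemma continuous_rnormP (T : topologicalType) (V : normedModType R[i]) (g : T -> V) x :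
  {for x, continuous g} <->
  forall e : R, 0 < e -> \forall y \near x, rnorm (g y - g x) < e.
Proof. exact: cvg_rnormP. Qed.

Lemma continuous_rnorm (T : topologicalType) (V : normedModType R[i]) (g : T -> V) :
  continuous g -> continuous (fun x => rnorm (g x)).
Proof.
move=> g_cts x; apply/cvgrPdist_lt => e e0.
apply: filterS ((continuous_rnormP g x).1 (g_cts x) e e0) => y; apply: le_lt_trans.
have := rnormD (g y - g x) (g x); have := rnormD (g x - g y) (g y).
by rewrite !subrK [rnorm (g x - g y)]rdistC ler_norml; lra.
Qed.

Lemma C0P f : C0 f <-> continuous f /\
  forall e : R, 0 < e -> compact [set x | e <= rnorm (f x)].
Proof.
split=> -[f_cts f_cpt]; split=> // e e0.
  have e0' : 0 < e%:C by rewrite ltcR.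
  by have := f_cpt _ e0'; under eq_set do rewrite rnormE lecR.
have eE := normc_RRe (ltW e0); have e0' : 0 < complex.Re e by rewrite -ltcR -eE.
by have := f_cpt _ e0'; under eq_set do rewrite -lecR -rnormE -eE.
Qed.

(** The closure properties of C_0(X) reduce to this: the set where [g]
    is large is closed and contained in a union of two compact sets. *)
Lemma C0_dominated f1 f2 g : C0 f1 -> C0 f2 -> continuous g ->
  (forall e : R, 0 < e -> exists2 d : R, 0 < d &
     forall x, e <= rnorm (g x) -> d <= rnorm (f1 x) \/ d <= rnorm (f2 x)) ->
  C0 g.
Proof.
move=> /C0P[_ f1_cpt] /C0P[_ f2_cpt] g_cts dom; apply/C0P; split=> // e e0.
have [d d0 sub] := dom e e0.
apply: (subclosed_compact _ (compactU (f1_cpt d d0) (f2_cpt d d0))) => //.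
by have := closed_comp (fun x _ => continuous_rnorm g_cts (x:=x)) (@closed_ge R e).
Qed.

Lemma C0D f g : C0 f -> C0 g -> C0 (f + g).
Proof.
move=> f0 g0; apply: (C0_dominated f0 g0) => [x|e e0].
  by apply: cvgD; [case: f0 => + _; apply | case: g0 => + _; apply].
exists (e / 2) => [|x]; first by rewrite divr_gt0.
have := rnormD (f x) (g x) => fg efg.
have {efg} : e <= rnorm (f x) + rnorm (g x) by apply: le_trans efg _.
by case: (lerP (e / 2) (rnorm (f x))) => ? ?; [left | right; lra].
Qed.

Lemma C0M f g : C0 f -> C0 g -> C0 (f * g).
Proof.
move=> f0 g0; apply: (C0_dominated f0 g0) => [x|e e0].
  by apply: cvgM; [case: f0 => + _; apply | case: g0 => + _; apply].
exists (Num.sqrt e) => [|x]; first by rewrite sqrtr_gt0.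
rewrite fctE rnormM.
case: (lerP (Num.sqrt e) (rnorm (f x))) => fe; first by left.
case: (lerP (Num.sqrt e) (rnorm (g x))) => ge; first by right.
rewrite leNgt -[ltRHS](sqr_sqrtr (ltW e0)) expr2 => /negP[].
by apply: ltr_pM => //; exact: rnorm_ge0.
Qed.

Lemma C0_scale (z : R[i]) f : C0 f -> C0 (z *: f).
Proof.
move=> f0; apply: (C0_dominated f0 f0) => [x|e e0].
  by apply: cvgZr; case: f0 => + _; apply.
have z1 : 0 < rnorm (z : R[i]^o) + 1 by rewrite ltr_wpDl// rnorm_ge0.
exists (e / (rnorm (z : R[i]^o) + 1)) => [|x]; first by rewrite divr_gt0.
rewrite fctE rnormZ => le_e; left; rewrite ler_pdivrMr// mulrC.
by apply: le_trans le_e _; rewrite ler_wpM2r ?rnorm_ge0// lerDl.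
Qed.

Lemma C0_conj_C0 f : C0 f -> C0 (C0_conj f).
Proof.
move=> f0; apply: (C0_dominated f0 f0) => [x|e e0].
  apply/continuous_rnormP => e e0; case: f0 => /(_ x)/continuous_rnormP/(_ e e0) + _.
  by apply: filterS => y; rewrite /C0_conj -rmorphB rnorm_conjC.
by exists e => // x; rewrite /C0_conj rnorm_conjC; left.
Qed.

Definition realC (g : X -> R) : X -> R[i]^o := fun x => (g x)%:C.

Lemma continuous_realC (g : X -> R) : continuous (realC g) <-> continuous g.
Proof.
split=> g_cts x.
  apply/cvgrPdist_lt => e e0.
  apply: filterS ((continuous_rnormP _ _).1 (g_cts x) e e0) => y.
  by rewrite -rmorphB rnorm_realC distrC.
apply/continuous_rnormP => e e0.
have /cvgrPdist_lt/(_ e e0) := g_cts x; apply: filterS => y.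
by rewrite -rmorphB rnorm_realC distrC.
Qed.

Lemma C0_re f : C0 f -> C0 (realC (fun x => complex.Re (f x))).
Proof.
have re_le (z : R[i]) : `|complex.Re z| <= rnorm (z : R[i]^o).
  by rewrite -lecR -rnormE normc_ge_Re.
move=> f0; apply: (C0_dominated f0 f0) => [|e e0].
  apply/continuous_realC => x; apply/cvgrPdist_lt => e e0.
  case: f0 => /(_ x)/continuous_rnormP/(_ e e0) + _; apply: filterS => y.
  by apply: le_lt_trans; rewrite distrC -raddfB re_le.
by exists e => // x; rewrite rnorm_realC => le_e; left; apply: le_trans le_e _.
Qed.

Lemma C0_comp (f0 : X -> R) (F : R -> R) : C0 (realC f0) -> continuous F ->
  F 0 = 0 -> C0 (realC (F \o f0)).
Proof.
move=> f_C0 F_cts F0; have f_cts : continuous f0 by case: f_C0 => /continuous_realC.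
apply: (C0_dominated f_C0 f_C0) => [|e e0].
  by apply/continuous_realC => x; apply: continuous_comp; [exact: f_cts | exact: F_cts].
have /cvgrPdist_lt/(_ e e0) := F_cts 0; rewrite nearE => /nbhs_ballP[d /= d0 sub].
exists d => // x; rewrite !rnorm_realC => le_e; left; rewrite leNgt; apply/negP => fd.
have := sub (f0 x); rewrite /ball /= sub0r normrN F0 sub0r normrN => /(_ fd).
by rewrite ltNge le_e.
Qed.

Lemma C0_real_bounded (f0 : X -> R) : C0 (realC f0) ->
  exists N : nat, forall x, `|f0 x| <= N%:R.
Proof.
move=> f_C0; have f_cts : continuous f0 by case: f_C0 => /continuous_realC.
have /C0P[_ /(_ 1 ltr01) K_cpt] := f_C0.
have : compact (f0 @` [set x | 1 <= rnorm (realC f0 x)]).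
  by apply: continuous_compact => //; apply: continuous_subspaceT.
move=> /compact_bounded[M [_ /(_ (`|M| + 1))]].
rewrite (le_lt_trans (ler_norm M)) ?ltrDl// => /(_ isT) f_le.
exists (Num.truncn (`|M| + 1)).+1 => x.
have M_lt : `|M| + 1 < (Num.truncn (`|M| + 1)).+1%:R by rewrite truncnS_gt.
case: (lerP 1 `|f0 x|) => fx.
  apply: le_trans (ltW M_lt); apply: f_le; exists x => //=.
  by rewrite rnorm_realC.
by apply: le_trans (ltW fx) _; rewrite ler1n.
Qed.

End C0Functions.

(** * The action of C_0(X) *)
Section Action.
Variables (R : realType) (X : topologicalType) (A : C0_algebra R X).
Implicit Types (f g : X -> R[i]^o) (a b : A).

Let theta := C0_structure A.
Let theta_P : is_C0_structure theta := C0_structureP A.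

Lemma C0_actDl f g a : C0 f -> C0 g ->
  C0_act (f + g) a = C0_act f a + C0_act g a.
Proof. by move=> f0 g0; rewrite /C0_act -/theta (C0_structureD theta_P). Qed.

Lemma C0_actZl (z : R[i]) f a : C0 f -> C0_act (z *: f) a = z *: C0_act f a.
Proof. by move=> f0; rewrite /C0_act -/theta (C0_structureZ theta_P). Qed.

Lemma C0_actM f g a : C0 f -> C0 g ->
  C0_act (f * g) a = C0_act f (C0_act g a).
Proof. by move=> f0 g0; rewrite /C0_act -/theta (C0_structureM theta_P). Qed.

Let theta_multiplier f : C0 f -> multiplier (theta f).
Proof. by move=> f0; case: (C0_structure_center theta_P f0). Qed.

Lemma C0_act_linear f : C0 f -> linear (C0_act f : A -> A).
Proof. by move=> /theta_multiplier[[]]. Qed.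

Lemma C0_act_bounded f : C0 f ->
  exists2 M : R, 0 <= M & forall a, rnorm (C0_act f a) <= M * rnorm a.
Proof.
move=> /theta_multiplier[[_ [M M_le]] _ _ _ _].
exists `|complex.Re M| => // a; have := M_le a.
have ReM (c : R) : complex.Re (M * c%:C) = complex.Re M * c.
  by case: (M) => x y /=; rewrite mulr0 subr0.
rewrite /= !rnormE lecE => /andP[_]; rewrite ReM => /le_trans; apply.
by rewrite ler_wpM2r ?rnorm_ge0// ler_norm.
Qed.

(** The multiplier [theta f] and its adjoint [theta (conj f)] are linked by
    the balancing condition of a double centralizer. *)
Lemma C0_act_star f a b : C0 f ->
  cmul (cstar (C0_act f a)) b = cmul (cstar a) (C0_act (C0_conj f) b).
Proof.
move=> f0; have [_ _ _ _ bal] := theta_multiplier f0.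
rewrite /C0_act -/theta (C0_structure_star theta_P)//=.
by rewrite -cstarM -bal cstarM cstarK.
Qed.

Lemma C0_actDr f a b : C0 f -> C0_act f (a + b) = C0_act f a + C0_act f b.
Proof. by move=> /C0_act_linear /(_ 1 a b); rewrite !scale1r. Qed.

Lemma C0_act0r f : C0 f -> C0_act f (0 : A) = 0.
Proof.
move=> f0; have := C0_actDr 0 0 f0.
by rewrite addr0 => /eqP; rewrite -subr_eq0 opprD addrA subrr sub0r oppr_eq0 => /eqP.
Qed.

Lemma C0_actZr f (z : R[i]) a : C0 f -> C0_act f (z *: a) = z *: C0_act f a.
Proof. by move=> f0; have := C0_act_linear f0 z a 0; rewrite !addr0 C0_act0r// addr0. Qed.

Lemma C0_actNr f a : C0 f -> C0_act f (- a) = - C0_act f a.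
Proof. by move=> f0; rewrite -scaleN1r C0_actZr// scaleN1r. Qed.

Lemma C0_actBr f a b : C0 f -> C0_act f (a - b) = C0_act f a - C0_act f b.
Proof. by move=> f0; rewrite C0_actDr// C0_actNr. Qed.

Lemma C0_act_sumr f (I : Type) (r : seq I) (P : pred I) (F : I -> A) : C0 f ->
  C0_act f (\sum_(i <- r | P i) F i) = \sum_(i <- r | P i) C0_act f (F i).
Proof.
by move=> f0; apply: big_morph => [x y|]; [exact: C0_actDr | exact: C0_act0r].
Qed.

Lemma C0_cst0 : C0 (0 : X -> R[i]^o).
Proof.
apply/C0P; split=> [x|e e0]; first exact: cvg_cst.
have -> : [set x : X | e <= rnorm ((0 : X -> R[i]^o) x)] = set0.
  apply/seteqP; split=> // x.
  by rewrite /= -[(0 : X -> R[i]^o) x]/(0 : R[i]^o) rnorm0 leNgt e0.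
exact: compact0.
Qed.

Lemma C0_act0l a : C0_act (0 : X -> R[i]^o) a = 0.
Proof. by rewrite -(scale0r (0 : X -> R[i]^o)) C0_actZl ?scale0r//; exact: C0_cst0. Qed.

Lemma C0_ideal0 (U : set X) : C0_ideal U (0 : A).
Proof.
exists 0, 0; rewrite -/(C0_act 0 0) C0_act0l.
by split=> //; split=> //; exact: C0_cst0.
Qed.

Lemma C0_idealN (U : set X) a : C0_ideal U a -> C0_ideal U (- a).
Proof.
move=> [f [b [fU ->]]]; exists f, (- b); split=> //.
by rewrite -/(C0_act f (- b)) C0_actNr//; case: fU.
Qed.

(** * Functional calculus along a real function *)
Section FunctionalCalculus.
Variable f : X -> R.
Hypothesis f_C0 : C0 (realC f).
Implicit Types F G : R -> R.

(** This is multiplication by the bounded function [F o f].  That function need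
    not vanish at infinity, but it differs from the constant [F 0] by an
    element of C_0(X), on which the action is given. *)
Definition fcalc F a : A :=
  (F 0)%:C *: a + C0_act (realC (fun x => F (f x) - F 0)) a.

Lemma C0_fcalc F : continuous F -> C0 (realC (fun x => F (f x) - F 0)).
Proof.
move=> F_cts; apply: (@C0_comp _ _ f (fun s => F s - F 0)) => //; last exact: subrr.
by move=> x; apply: cvgB; [exact: F_cts | exact: cvg_cst].
Qed.

Lemma fcalc_ext F G a :
  (forall x, F (f x) = G (f x)) -> F 0 = G 0 -> fcalc F a = fcalc G a.
Proof.
move=> FG FG0; rewrite /fcalc FG0; congr (_ + C0_act (realC _) a).
by apply/funext => x; rewrite FG.
Qed.

Lemma fcalc_id a : fcalc id a = C0_act (realC f) a.
Proof.
rewrite /fcalc scale0r add0r; congr (C0_act _ a).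
by apply/funext => x; rewrite /realC subr0.
Qed.

Lemma fcalc_cst (c : R) a : fcalc (cst c) a = c%:C *: a.
Proof.
rewrite /fcalc (_ : realC _ = 0) ?C0_act0l ?addr0//.
by apply/funext => x; rewrite /realC /= subrr.
Qed.

Lemma fcalcD F G a : continuous F -> continuous G ->
  fcalc (F + G) a = fcalc F a + fcalc G a.
Proof.
move=> F_cts G_cts; rewrite /fcalc [RHS]addrACA -scalerDl -rmorphD.
rewrite -(C0_actDl _ (C0_fcalc F_cts) (C0_fcalc G_cts)).
congr (_ + C0_act _ a); apply/funext => x.
by rewrite /realC !fctE -rmorphD opprD addrACA.
Qed.

Lemma fcalcM F G a : continuous F -> continuous G ->
  fcalc (F * G) a = fcalc F (fcalc G a).
Proof.
move=> F_cts G_cts; have [F0 G0] := (C0_fcalc F_cts, C0_fcalc G_cts).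
rewrite /fcalc scalerDr scalerA -rmorphM -addrA; congr (_ + _).
rewrite C0_actDr// C0_actZr// -C0_actM// -!C0_actZl// -!C0_actDl//;
  do ?[exact: C0D | exact: C0M | exact: C0_scale]; last first.
  by apply: C0D; [exact: C0_scale | exact: C0M].
congr (C0_act _ a); apply/funext => x; rewrite /realC !fctE.
rewrite -[(F 0)%:C *: _]/((F 0)%:C * _) -[(G 0)%:C *: _]/((G 0)%:C * _).
by rewrite -!rmorphM -!rmorphD; congr (_%:C); ring.
Qed.

Lemma fcalcBr F a b : continuous F -> fcalc F (a - b) = fcalc F a - fcalc F b.
Proof.
move=> F_cts; rewrite /fcalc (C0_actBr _ _ (C0_fcalc F_cts)) scalerBr opprD.
exact: addrACA.
Qed.

Lemma fcalc_star F a b : continuous F ->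
  cmul (cstar (fcalc F a)) b = cmul (cstar a) (fcalc F b).
Proof.
move=> F_cts; rewrite /fcalc cstarD cstarZ conjC_realC cmulDl cmulDr cmulZl cmulZr.
congr (_ + _); rewrite (C0_act_star _ _ (C0_fcalc F_cts)); congr (cmul _ (C0_act _ b)).
by apply/funext => x; rewrite /C0_conj conjC_realC.
Qed.

Lemma fcalc_scale (c : R) F a : continuous F ->
  fcalc (fun s => c * F s) a = c%:C *: fcalc F a.
Proof.
move=> F_cts; rewrite -[LHS]/(fcalc (cst c * F) a) fcalcM ?fcalc_cst// => x.
exact: cvg_cst.
Qed.

Lemma fcalc_sum (F_ : nat -> R -> R) a (n : nat) : (forall k : nat, continuous (F_ k)) ->
  fcalc (\sum_(k < n) F_ k) a = \sum_(k < n) fcalc (F_ k) a.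
Proof.
move=> F_cts; elim: n => [|n IHn].
  rewrite !big_ord0 -[0 : R -> R]/(cst 0) fcalc_cst; exact: scale0r.
rewrite !big_ord_recr /= fcalcD ?IHn//.
elim: n {IHn} => [|n IHn] x; first by rewrite big_ord0; exact: cvg_cst.
by rewrite big_ord_recr; apply: cvgD; [exact: IHn | exact: F_cts].
Qed.

(** Here the two legs of the rotation are [F] and [sqrt (1 - F^2)]: their
    squares add up to [1], and they commute.  Square roots are available because
    [fcalc] accepts functions that do not vanish at [0]. *)
Lemma seminorm_fcalc_le (L : A -> R) F a : cstar_seminorm L -> continuous F ->
  (forall s, `|F s| <= 1) -> L (fcalc F a) <= L a.
Proof.
move=> L_sn F_cts F_le1; pose G s := Num.sqrt (1 - F s ^+ 2).
have G_cts : continuous G.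
  move=> s; apply: (continuous_comp (f := fun s => 1 - F s ^+ 2)).
    by apply: cvgB; [exact: cvg_cst | apply: cvgM; exact: F_cts].
  exact: sqrt_continuous.
have FG : F * F + G * G = cst 1.
  apply/funext => s; rewrite !fctE -!expr2 sqr_sqrtr; first by rewrite addrC subrK.
  by rewrite subr_ge0 -real_normK ?num_real// exprn_ile1.
apply: (seminorm_pythagoras L_sn (y := fcalc G a)).
  rewrite !fcalc_star// -!fcalcM// -cmulDr -fcalcD ?FG ?fcalc_cst ?scale1r//.
    by move=> s; apply: cvgM; exact: F_cts.
  by move=> s; apply: cvgM; exact: G_cts.
by rewrite !fcalc_star// -!fcalcM// mulrC.
Qed.

Lemma seminorm_fcalc_le_scale (L : A -> R) F (c : R) a :
  cstar_seminorm L -> continuous F -> 0 < c -> (forall s, `|F s| <= c) -> L (fcalc F a) <= c * L a.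
Proof.
move=> L_sn F_cts c0 F_le.
have cts : continuous (fun s => c^-1 * F s).
  by move=> s; apply: cvgM; [exact: cvg_cst | exact: F_cts].
have -> : fcalc F a = c%:C *: fcalc (fun s => c^-1 * F s) a.
  by rewrite fcalc_scale// scalerA -rmorphM /= mulfV ?gt_eqF// scale1r.
rewrite (seminormZr L_sn) gtr0_norm// ler_wpM2l ?(ltW c0)//.
apply: seminorm_fcalc_le => // s.
by rewrite normrM ger0_norm ?invr_ge0 ?(ltW c0)// ler_pdivrMl// mulr1.
Qed.

End FunctionalCalculus.
End Action.

(** * The limit superior seminorm of an asymptotic morphism *)
Section LimsupNorm.
Variables (R : realType) (B : cstarAlgType R).
Implicit Types g h : R -> B.

Definition eventually_bounded g :=
  exists M : R, \forall t \near +oo, rnorm (g t) <= M.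

(** The limit superior of [|g t|] as [t] tends to infinity; it is meaningful
    for eventually bounded [g], where the infimum is over a nonempty set. *)
Definition limsup_norm g : R :=
  inf [set c : R | \forall t \near +oo, rnorm (g t) <= c].

Lemma limsup_normP g c : eventually_bounded g ->
  limsup_norm g <= c <->
  forall e : R, 0 < e -> \forall t \near +oo, rnorm (g t) <= c + e.
Proof.
move=> [M gM].
have lb0 : lbound [set c : R | \forall t \near +oo, rnorm (g t) <= c] 0.
  by move=> d /= /filter_ex[t]; apply: le_trans; exact: rnorm_ge0.
split=> [le_c e e0|le_c].
  have E_inf : has_inf [set c : R | \forall t \near +oo, rnorm (g t) <= c].
    by split; [exists M | exists 0].
  have [d /= gd d_lt] := inf_adherent e0 E_inf.
  apply: filterS gd => t /le_trans; apply; apply: ltW; apply: lt_le_trans d_lt _.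
  by rewrite lerD2r.
apply/ler_addgt0Pr => e e0; apply: ge_inf; first by exists 0.
exact: le_c.
Qed.

Lemma limsup_norm_ge0 g : eventually_bounded g -> 0 <= limsup_norm g.
Proof.
move=> [M gM]; apply: lb_le_inf; first by exists M.
by move=> d /= /filter_ex[t]; apply: le_trans; exact: rnorm_ge0.
Qed.

Lemma limsup_norm_near g e : eventually_bounded g -> 0 < e ->
  \forall t \near +oo, rnorm (g t) <= limsup_norm g + e.
Proof. by move=> gb; exact: ((limsup_normP (limsup_norm g) gb).1 (lexx _)). Qed.

Lemma limsup_norm0P g : eventually_bounded g ->
  limsup_norm g <= 0 <-> g t @[t --> +oo] --> (0 : B).
Proof.
move=> gb; rewrite (limsup_normP 0 gb) cvg0_rnormP; split=> g0 e e0.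
  have e20 : 0 < e / 2 by rewrite divr_gt0.
  by apply: filterS (g0 _ e20) => t; move: e0; lra.
by apply: filterS (g0 e e0) => t /ltW; rewrite add0r.
Qed.

Lemma eventually_boundedD g h : eventually_bounded g -> eventually_bounded h ->
  eventually_bounded (g + h).
Proof.
move=> [M gM] [N hN]; exists (M + N); apply: filterS2 gM hN => t gt ht.
by apply: le_trans (rnormD _ _) _; apply: lerD.
Qed.

Lemma limsup_normD g h : eventually_bounded g -> eventually_bounded h ->
  limsup_norm (g + h) <= limsup_norm g + limsup_norm h.
Proof.
move=> gb hb; apply/limsup_normP => [|e e0]; first exact: eventually_boundedD.
have e20 : 0 < e / 2 by rewrite divr_gt0.
apply: filterS2 (limsup_norm_near gb e20) (limsup_norm_near hb e20) => t gt ht.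
by apply: le_trans (rnormD _ _) _; lra.
Qed.

Lemma limsup_norm_eq g h : eventually_bounded g -> eventually_bounded h ->
  (g - h) t @[t --> +oo] --> (0 : B) -> limsup_norm g = limsup_norm h.
Proof.
suff le g' h' : eventually_bounded g' -> eventually_bounded h' ->
    (g' - h') t @[t --> +oo] --> (0 : B) -> limsup_norm g' <= limsup_norm h'.
  move=> gb hb gh; apply/eqP; rewrite eq_le !le//.
  by rewrite -opprB -oppr0; apply: cvgN.
move=> gb hb /cvg0_rnormP gh; apply/limsup_normP => // e e0.
have e20 : 0 < e / 2 by rewrite divr_gt0.
apply: filterS2 (limsup_norm_near hb e20) (gh _ e20) => t ht ght.
rewrite -[g' t](subrK (h' t)); apply: le_trans (rnormD _ _) _.
by move: ght; rewrite !fctE; lra.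
Qed.

Lemma eventually_boundedZ (z : R[i]) g : eventually_bounded g ->
  eventually_bounded (z *: g).
Proof.
move=> [M gM]; exists (rnorm (z : R[i]^o) * M); apply: filterS gM => t gt.
by rewrite rnormZ ler_wpM2l//; exact: rnorm_ge0 (z : R[i]^o).
Qed.

Lemma limsup_normZ (z : R[i]) g : eventually_bounded g ->
  limsup_norm (z *: g) = rnorm (z : R[i]^o) * limsup_norm g.
Proof.
have leZ (w : R[i]) h : eventually_bounded h ->
    limsup_norm (w *: h) <= rnorm (w : R[i]^o) * limsup_norm h.
  move=> hb; apply/limsup_normP => [|e e0]; first exact: eventually_boundedZ.
  have w0 := rnorm_ge0 (w : R[i]^o).
  have w1 : 0 < rnorm (w : R[i]^o) + 1 by rewrite ltr_wpDl.
  have e'0 : 0 < e / (rnorm (w : R[i]^o) + 1) by rewrite divr_gt0.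
  apply: filterS (limsup_norm_near hb e'0) => t ht; rewrite rnormZ.
  apply: le_trans (ler_wpM2l w0 ht) _; rewrite mulrDr lerD2l.
  by rewrite mulrCA -[leRHS]mulr1 ler_wpM2l ?(ltW e0)// ler_pdivrMr// mul1r lerDl.
move=> gb; have [->|z0] := eqVneq z 0.
  have b0 : eventually_bounded (0 : R -> B) by exists 0; near=> t; rewrite rnorm0.
  rewrite scale0r rnorm0 mul0r; apply/eqP; rewrite eq_le limsup_norm_ge0// andbT.
  by apply/limsup_norm0P => //; exact: cvg_cst.
apply/eqP; rewrite eq_le leZ//=.
have zz : rnorm (z^-1 : R[i]^o) * rnorm (z : R[i]^o) = 1.
  by rewrite -rnormM mulVf// /rnorm normr1.
have := leZ z^-1 (z *: g) (eventually_boundedZ z gb).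
rewrite scalerA mulVf// scale1r => /(ler_wpM2l (rnorm_ge0 (z : R[i]^o))).
by rewrite mulrA [_ * rnorm (z^-1 : R[i]^o)]mulrC zz mul1r.
Unshelve. all: by end_near.
Qed.

Definition cstar_sqr g : R -> B := fun t => cmul (cstar (g t)) (g t).

Lemma eventually_bounded_cstar_sqr g : eventually_bounded g ->
  eventually_bounded (cstar_sqr g).
Proof.
move=> [M gM]; exists (M ^+ 2); apply: filterS gM => t gt.
by rewrite rnorm_cstar_cmul ler_sqr ?nnegrE ?rnorm_ge0// (le_trans _ gt) ?rnorm_ge0.
Qed.

Lemma limsup_norm_cstar_sqr g : eventually_bounded g ->
  limsup_norm (cstar_sqr g) = limsup_norm g ^+ 2.
Proof.
move=> gb; have ggb := eventually_bounded_cstar_sqr gb.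
have l0 := limsup_norm_ge0 gb; have m0 := limsup_norm_ge0 ggb.
apply/eqP; rewrite eq_le; apply/andP; split.
  apply/(limsup_normP _ ggb) => e e0; set l := limsup_norm g in l0 *.
  have l1 : 0 < 2 * l + 1 by lra.
  (* chosen so that (l + d)^2 <= l^2 + e *)
  pose d := Num.min 1 (e / (2 * l + 1)).
  have d0 : 0 < d by rewrite lt_min ltr01 divr_gt0.
  have d1 : d <= 1 by rewrite ge_min lexx.
  have de : d * (2 * l + 1) <= e by rewrite -ler_pdivlMr// ge_min lexx orbT.
  apply: filterS (limsup_norm_near gb d0) => t gt; rewrite rnorm_cstar_cmul.
  have : rnorm (g t) ^+ 2 <= (l + d) ^+ 2.
    by rewrite ler_sqr ?nnegrE ?rnorm_ge0// addr_ge0// ltW.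
  by move/le_trans; apply; nra.
rewrite -[leRHS]sqr_sqrtr// ler_sqr ?nnegrE ?sqrtr_ge0//.
apply/(limsup_normP _ gb) => e e0.
apply: filterS (limsup_norm_near ggb (exprn_gt0 2 e0)) => t.
rewrite rnorm_cstar_cmul => gt.
rewrite -(@ler_pXn2r _ 2)// ?nnegrE ?rnorm_ge0 ?addr_ge0 ?sqrtr_ge0 ?(ltW e0)//.
apply: le_trans gt _; rewrite sqrrD sqr_sqrtr// addrAC lerDl.
by rewrite mulrn_wge0// mulr_ge0 ?sqrtr_ge0 ?(ltW e0).
Qed.

End LimsupNorm.

Section AsymptoticSeminorm.
Variables (R : realType) (A B : cstarAlgType R) (phi : A -> R -> B).
Hypothesis phi_asym : asymptotic_morphism phi.

Lemma asymptotic_bounded a : eventually_bounded (phi a).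
Proof.
have [_ [M [_ /(_ (M + 1))]]] := asymptotic_Cb phi_asym a.
rewrite ltrDl ltr01 => /(_ isT) phi_le; exists (complex.Re (M + 1)).
near=> t; have : `|phi a t| <= M + 1.
  by apply: phi_le; rewrite /= in_itv/= andbT; near: t; exact: nbhs_pinfty_ge.
by rewrite rnormE lecE => /andP[].
Unshelve. all: by end_near.
Qed.

(** Changing a function by one that tends to [0] does not affect the limit
    superior, so the asymptotic identities satisfied by [phi] become exact. *)
Lemma asymptotic_seminorm : cstar_seminorm (fun a => limsup_norm (phi a)).
Proof.
have b := asymptotic_bounded.
split=> [a a'|z a|a].
- rewrite (limsup_norm_eq (b _) (eventually_boundedD (b a) (b a'))).
    exact: limsup_normD.
  by have [] := asymptoticD phi_asym a a'.
- rewrite (limsup_norm_eq (b _) (eventually_boundedZ z (b a))).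
    exact: limsup_normZ.
  by have [] := asymptoticZ phi_asym z a.
rewrite -limsup_norm_cstar_sqr//; apply: limsup_norm_eq => //.
  exact: eventually_bounded_cstar_sqr.
have [M aM] := b a.
have [_ mul0] := asymptoticM phi_asym (cstar a) a.
have [_ star0] := asymptotic_star phi_asym a.
have star_mul0 : cmul ((phi (cstar a) - (fun t => cstar (phi a t))) t) (phi a t)
    @[t --> +oo] --> (0 : B).
  apply/cvg0_rnormP => e e0; have M1 : 0 < `|M| + 1 by rewrite ltr_wpDl.
  have e'0 : 0 < e / (`|M| + 1) by rewrite divr_gt0.
  have /cvg0_rnormP/(_ _ e'0) := star0; apply: filterS2 aM => t aM.
  rewrite ltr_pdivlMr// => star_t; apply: le_lt_trans (rnorm_cmul _ _) _.
  apply: le_lt_trans star_t; rewrite ler_wpM2l ?rnorm_ge0//.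
  by rewrite (le_trans aM)// (le_trans (ler_norm M))// lerDl.
apply/cvg0_rnormP => e e0; have e20 : 0 < e / 2 by rewrite divr_gt0.
move/cvg0_rnormP/(_ _ e20) in mul0; move/cvg0_rnormP/(_ _ e20) in star_mul0.
apply: filterS2 mul0 star_mul0 => t mul_t star_t.
have -> : (phi (cmul (cstar a) a) - cstar_sqr (phi a)) t =
    (phi (cmul (cstar a) a) - (fun t => cmul (phi (cstar a) t) (phi a t))) t +
    cmul ((phi (cstar a) - (fun t => cstar (phi a t))) t) (phi a t).
  by rewrite !fctE /cstar_sqr cmulBl addrA subrK.
by apply: le_lt_trans (rnormD _ _) _; lra.
Qed.

End AsymptoticSeminorm.

(** * A partition of unity on an interval *)
Section Hats.
Variables (R : realType) (n c : R).
Hypothesis n_gt0 : 0 < n.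

Definition clip (s : R) : R := Num.max 0 (Num.min 1 s).
(** A hat is the difference of two consecutive translates of one clipped ramp, so
    that sums of hats telescope. *)
Definition hat (k : nat) (s : R) : R :=
  clip (n * (s + c) + 1 - k%:R) - clip (n * (s + c) - k%:R).
Definition node (k : nat) : R := k%:R / n - c.

Lemma continuous_clip : continuous clip.
Proof.
move=> s; apply: continuous_max; first exact: cvg_cst.
by apply: continuous_min; [exact: cvg_cst | exact: cvg_id].
Qed.

Lemma continuous_hat k : continuous (hat k).
Proof.
have aff : continuous (fun s => n * (s + c)).
  move=> s; apply: cvgM; first exact: cvg_cst.
  by apply: cvgD; [exact: cvg_id | exact: cvg_cst].
have clip_aff (d : R) : continuous (fun s => clip (n * (s + c) - d)).
  move=> s; apply: (@continuous_comp _ _ _ (fun s => n * (s + c) - d) clip).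
    by apply: cvgB; [exact: aff | exact: cvg_cst].
  exact: continuous_clip.
have -> : hat k = fun s => clip (n * (s + c) - (k%:R - 1)) - clip (n * (s + c) - k%:R).
  by apply/funext => s; rewrite /hat opprB addrA.
by move=> s; apply: cvgB; exact: clip_aff.
Qed.

Lemma clip_itv s : 0 <= clip s <= 1.
Proof. by rewrite /clip le_max lexx ge_max ler01 ge_min lexx. Qed.

Lemma clip_homo s t : s <= t -> clip s <= clip t.
Proof.
move=> st; rewrite /clip; case: (leP 1 s); case: (leP 1 t); rewrite /Num.max;
  by do ?case: ifP; lra.
Qed.

Lemma clip_ge1 s : 1 <= s -> clip s = 1.
Proof. by move=> s1; rewrite /clip min_l// max_r. Qed.

Lemma clip_le0 s : s <= 0 -> clip s = 0.
Proof. by move=> s0; rewrite /clip min_r ?max_l// (le_trans s0). Qed.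

Lemma hat_ge0 k s : 0 <= hat k s.
Proof. by rewrite /hat subr_ge0 clip_homo//; lra. Qed.

Lemma hat_le1 k s : hat k s <= 1.
Proof.
rewrite /hat; have /andP[_ +] := clip_itv (n * (s + c) + 1 - k%:R).
by have /andP[+ _] := clip_itv (n * (s + c) - k%:R); lra.
Qed.

Lemma hat_support k s : hat k s != 0 -> `|s - node k| < n^-1.
Proof.
apply: contraNT; rewrite -leNgt -(ler_pM2l n_gt0) mulfV ?lt0r_neq0//.
rewrite -[X in X * _](gtr0_norm n_gt0) -normrM.
have -> : n * (s - node k) = n * (s + c) - k%:R.
  by rewrite /node; field; rewrite gt_eqF.
rewrite /hat ler_normr => /orP[] le1.
  by rewrite clip_ge1; [rewrite clip_ge1 ?subrr//|]; lra.
by rewrite clip_le0; [rewrite clip_le0 ?subrr//|]; lra.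
Qed.

Lemma sum_hat m s : \sum_(k < m) hat k s =
  clip (n * (s + c) + 1) - clip (n * (s + c) + 1 - m%:R).
Proof.
elim: m => [|m IHm]; first by rewrite big_ord0 subr0 subrr.
rewrite big_ord_recr /= IHm /hat -[m.+1%:R]natr1.
have -> : n * (s + c) + 1 - (m%:R + 1) = n * (s + c) - m%:R by ring.
by rewrite addrA subrK.
Qed.

Lemma sum_hat_eq1 m s : 0 <= s + c -> n * (s + c) + 1 <= m%:R ->
  \sum_(k < m) hat k s = 1.
Proof.
move=> sc_ge0 sc_le; rewrite sum_hat clip_ge1 ?clip_le0 ?subr0//; first by lra.
by rewrite lerDr mulr_ge0// ltW.
Qed.

Lemma sum_hat_le1 m s : \sum_(k < m) hat k s <= 1.
Proof.
rewrite sum_hat; have /andP[_ +] := clip_itv (n * (s + c) + 1).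
by have /andP[+ _] := clip_itv (n * (s + c) + 1 - m%:R); lra.
Qed.

(** Where [hat k] does not vanish, the node [k] is within [1/n] of [s]; the
    hats are nonnegative with sum at most [1]. *)
Lemma sum_hat_dist m s : `|\sum_(k < m) (s - node k) * hat k s| <= n^-1.
Proof.
apply: le_trans (ler_norm_sum _ _ _) _.
have n'_ge0 : 0 <= n^-1 by rewrite invr_ge0 ltW.
apply: (le_trans (y := \sum_(k < m) n^-1 * hat k s)); last first.
  by rewrite -mulr_sumr -[leRHS]mulr1 ler_wpM2l// sum_hat_le1.
apply: ler_sum => k _; rewrite normrM (ger0_norm (hat_ge0 _ _)).
have [->|/hat_support/ltW sk] := eqVneq (hat k s) 0; first by rewrite !mulr0.
by rewrite ler_wpM2r// hat_ge0.
Qed.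

End Hats.

(** * Almost orthogonal sums *)

(** Expanding [|sum x_k|^2] as the norm of the sum of all [x_j* x_k], only the
    entries on three diagonals survive, and each has norm at most [q^2].  The
    bound is linear in [m], whereas the triangle inequality would give
    [m^2 q^2]. *)
Lemma rnorm_sum_almost_orthogonal (R : realType) (B : cstarAlgType R) (m : nat)
    (x : nat -> B) (q : R) :
  (forall k, (k < m)%N -> rnorm (x k) <= q) ->
  (forall j k, (j.+1 < k)%N -> (k < m)%N -> cmul (cstar (x j)) (x k) = 0) ->
  rnorm (\sum_(k < m) x k) ^+ 2 <= 3 * m%:R * q ^+ 2.
Proof.
move=> x_le x_orth; rewrite -rnorm_cstar_cmul cstar_sum cmul_suml.
have q2_ge0 : 0 <= q ^+ 2 by exact: sqr_ge0.
have entry (j k : 'I_m) : rnorm (cmul (cstar (x j)) (x k)) <=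
    q ^+ 2 *+ (k == j :> nat) + q ^+ 2 *+ (k == j.+1 :> nat) +
    q ^+ 2 *+ (k.+1 == j :> nat).
  have le_q2 : rnorm (cmul (cstar (x j)) (x k)) <= q ^+ 2.
    apply: le_trans (rnorm_cmul _ _) _; rewrite rnorm_cstar expr2.
    by rewrite ler_pM ?rnorm_ge0 ?x_le.
  have [jk|kj|jk] := ltngtP j.+1 k.
  - by rewrite x_orth// rnorm0 !addr_ge0 ?mulrn_wge0.
  - have [jk'|kj'] := ltnP k.+1 j.
      have -> : cmul (cstar (x j)) (x k) = 0.
        by rewrite -[LHS]cstarK cstarM cstarK x_orth ?cstar0.
      by rewrite rnorm0 !addr_ge0 ?mulrn_wge0.
    apply: le_trans le_q2 _.
    have [->|kj1] := eqVneq (val k) (val j).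
      by rewrite mulr1n -addrA lerDl addr_ge0 ?mulrn_wge0.
    have -> : k.+1 == j :> nat by rewrite eq_sym; move: kj kj' kj1; rewrite /=; lia.
    by rewrite mulr1n lerDr addr_ge0 ?mulrn_wge0.
  - by apply: le_trans le_q2 _; rewrite mulr1n addrAC lerDr addr_ge0 ?mulrn_wge0.
have single (p : pred nat) : (forall i j, p i -> p j -> i = j) ->
    \sum_(k < m) q ^+ 2 *+ p k <= q ^+ 2.
  move=> p_inj; have [k0 pk0|no] := pickP (fun k : 'I_m => p k).
    rewrite (bigD1 k0)//= pk0 mulr1n big1 ?addr0// => k kk0.
    case pk: (p k) => //; case/eqP: kk0; apply/val_inj; exact: p_inj.
  by rewrite big1// => k _; rewrite no.
apply: le_trans (rnorm_sum _ _ _) _.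
have -> : 3 * m%:R * q ^+ 2 = \sum_(j < m) 3 * q ^+ 2.
  by rewrite sumr_const card_ord -[RHS]mulr_natr mulrAC.
apply: ler_sum => j _; rewrite cmul_sumr; apply: le_trans (rnorm_sum _ _ _) _.
apply: le_trans (ler_sum _ (fun k _ => entry j k)) _.
rewrite !big_split /=.
have := single (pred1 (val j)); have := single (pred1 j.+1).
have := single (fun k => k.+1 == j).
move=> s1 s2 s3; rewrite (_ : 3 * q ^+ 2 = q ^+ 2 + q ^+ 2 + q ^+ 2); last by ring.
apply: lerD; [apply: lerD|].
- by apply: s3 => i k /eqP-> /eqP->.
- by apply: s2 => i k /eqP-> /eqP->.
- by apply: s1 => i k /eqP <- /eqP[].
Qed.

(** * Elements localized where a function is nearly constant *)
Section Localization.
Variables (R : realType) (X : topologicalType) (A : C0_algebra R X).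
Variable f : X -> R.
Hypothesis f_C0 : C0 (realC f).
Implicit Types (g h : X -> R[i]^o) (a b : A) (F : R -> R).

Lemma C0_realC_comp_mul F g : continuous F -> C0 g -> C0 (realC (F \o f) * g).
Proof.
move=> F_cts g0; rewrite (_ : _ * g =
    (F 0)%:C *: g + realC (fun x => F (f x) - F 0) * g).
  by apply: C0D; [exact: C0_scale | apply: C0M => //; exact: C0_fcalc].
apply/funext => x; rewrite !fctE /realC -[(F 0)%:C *: _]/((F 0)%:C * _) -mulrDl.
by rewrite -rmorphD /= addrC subrK.
Qed.

(** On an element of the range of the action, multiplication by the bounded
    function [F o f] can be absorbed into C_0(X). *)
Lemma fcalc_C0_act F g a : continuous F -> C0 g ->
  fcalc f F (C0_act g a) = C0_act (realC (F \o f) * g) a.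
Proof.
move=> F_cts g0; rewrite /fcalc -C0_actM//; last exact: C0_fcalc.
rewrite -C0_actZl// -C0_actDl//; last 2 first.
- exact: C0_scale.
- by apply: C0M => //; exact: C0_fcalc.
congr (C0_act _ a); apply/funext => x.
rewrite !fctE /realC -[(F 0)%:C *: _]/((F 0)%:C * _) -mulrDl.
by rewrite -rmorphD /= addrC subrK.
Qed.

(** As [F 0] need not vanish, [F o f] itself may lie outside C_0(X); the factor
    [g] brings the product back into C_0(U). *)
Lemma fcalc_C0_act_ideal F g a (U : set X) : continuous F -> C0 g ->
  (forall x, ~ U x -> F (f x) = 0) -> C0_ideal U (fcalc f F (C0_act g a)).
Proof.
move=> F_cts g0 FU; exists (realC (F \o f) * g), a.
rewrite fcalc_C0_act//; split=> //; split; first exact: C0_realC_comp_mul.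
by move=> x Ux; rewrite !fctE /realC /= FU// mul0r.
Qed.

Lemma continuous_sub_cst (c : R) : continuous (fun s : R => s - c).
Proof. by move=> s; apply: cvgB; [exact: cvg_id | exact: cvg_cst]. Qed.

Lemma fcalc_sub (c : R) a : fcalc f (fun s => s - c) a = C0_act (realC f) a - c%:C *: a.
Proof.
rewrite -[X in fcalc f X](_ : id + cst (- c) = _)//.
rewrite fcalcD//; [by rewrite fcalc_id fcalc_cst rmorphN scaleNr | | ].
  by move=> s; exact: cvg_id.
by move=> s; exact: cvg_cst.
Qed.

(** On the open set carrying [a] the function [f - c] agrees with its
    truncation to [[-e, e]], and the truncation is globally bounded by [e]. *)
Lemma fcalc_sub_ideal_le (c e : R) a : 0 < e ->
  C0_ideal [set x | `|f x - c| < e] a ->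
  rnorm (fcalc f (fun s => s - c) a) <= e * rnorm a.
Proof.
move=> e0 [g [b [[g0 gU] ->]]]; rewrite -/(C0_act g b).
pose F s := Num.max (- e) (Num.min e (s - c)).
have F_cts : continuous F.
  move=> s; apply: (@continuous_max _ _ (cst (- e)) (fun s => Num.min e (s - c))).
    exact: cvg_cst.
  by apply: continuous_min; [exact: cvg_cst | exact: continuous_sub_cst].
have -> : fcalc f (fun s => s - c) (C0_act g b) = fcalc f F (C0_act g b).
  rewrite !fcalc_C0_act//; last exact: continuous_sub_cst.
  congr (C0_act _ b); apply/funext => x; rewrite !fctE.
  have [fx|/gU->] := pselect ([set x | `|f x - c| < e] x); last by rewrite !mulr0.
  congr (_ * _); rewrite /realC /F /=; congr (_%:C).
  by move: fx; rewrite /= ltr_norml => /andP[? ?]; rewrite min_r ?max_r// ltW.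
apply: (seminorm_fcalc_le_scale f_C0 _ (rnorm_seminorm A)) => // s.
rewrite ler_norml /F le_max lexx ge_max ge_min lexx /= andbT.
by rewrite (le_trans _ (ltW e0))// oppr_le0 ltW.
Qed.

(** The intervals of radius [e] around [c] and [d] are disjoint, so the two
    functions of C_0(X) that carry the elements have product zero. *)
Lemma fcalc_sub_orthogonal (c d e : R) a b : c + 2 * e <= d ->
  C0_ideal [set x | `|f x - c| < e] a ->
  C0_ideal [set x | `|f x - d| < e] b ->
  cmul (cstar (fcalc f (fun s => s - c) a)) (fcalc f (fun s => s - d) b) = 0.
Proof.
move=> cd [g [a' [[g0 gU] ->]]] [h [b' [[h0 hU] ->]]].
rewrite -/(C0_act g a') -/(C0_act h b').
have [cc dc] := (continuous_sub_cst (c := c), continuous_sub_cst (c := d)).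
have [gc hd] := (C0_realC_comp_mul cc g0, C0_realC_comp_mul dc h0).
rewrite !fcalc_C0_act// C0_act_star// -C0_actM//; last exact: C0_conj_C0.
rewrite (_ : _ * _ = 0) ?C0_act0l ?cmulr0//.
apply/funext => x; rewrite /C0_conj !fctE.
have [gx|/gU->] := pselect ([set x | `|f x - c| < e] x); last first.
  by rewrite mulr0 conjC0 mul0r.
have [hx|/hU->] := pselect ([set x | `|f x - d| < e] x); last by rewrite !mulr0.
by move: gx hx; rewrite /= !ltr_norml => /andP[? ?] /andP[? ?]; exfalso; lra.
Qed.

Lemma rnorm_sum_fcalc_sub_le (n c q : R) (m : nat) (b : nat -> A) : 0 < n ->
  (forall k, (k < m)%N -> C0_ideal [set x | `|f x - node n c k| < n^-1] (b k)) ->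
  (forall k, (k < m)%N -> rnorm (b k) <= q) ->
  rnorm (\sum_(k < m) fcalc f (fun s => s - node n c k) (b k)) ^+ 2 <=
    3 * m%:R * (q / n) ^+ 2.
Proof.
move=> n0 b_ideal b_le; have n'0 : 0 < n^-1 by rewrite invr_gt0.
apply: (@rnorm_sum_almost_orthogonal _ _ _
  (fun k => fcalc f (fun s => s - node n c k) (b k))) => [k km|j k jk km].
  apply: le_trans (fcalc_sub_ideal_le n'0 (b_ideal k km)) _.
  by rewrite mulrC ler_wpM2r ?b_le// ltW.
apply: (@fcalc_sub_orthogonal _ _ (n^-1)); last exact: b_ideal.
  rewrite /node -(ler_pM2r n0) mulrDl !mulrBl -mulrA !divfK ?lt0r_neq0//.
  rewrite mulVf ?lt0r_neq0// mulr1 -subr_ge0.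
  suff -> : k%:R - c * n - (j%:R - c * n + 2) = k%:R - (j + 2)%:R :> R.
    by rewrite subr_ge0 ler_nat addn2.
  by rewrite natrD; ring.
by apply: b_ideal; rewrite (ltn_trans _ km)// (ltn_trans _ jk).
Qed.

Lemma norm_on_lt (U : set X) a (e : R) : norm_on (~` U) a < e ->
  exists2 b, C0_ideal U b & rnorm (a - b) < e.
Proof.
rewrite /norm_on setCK; set E := [set complex.Re _ | _ in _] => lt_e.
have E_inf : has_inf E.
  split; first by exists (rnorm (a + 0)), 0; first exact: C0_ideal0.
  by exists 0 => _ [b _ <-]; exact: rnorm_ge0 (a + b).
have e0 : 0 < e - inf E by rewrite subr_gt0.
have [_ [b Ub <-]] := inf_adherent e0 E_inf.
rewrite [inf E + _]addrC subrK => ab; exists (- b); first exact: C0_idealN.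
by rewrite opprK.
Qed.

Lemma norm_on_ge0 (S : set X) a : 0 <= norm_on S a.
Proof.
apply: lb_le_inf; first by exists (rnorm (a + 0)), 0; first exact: C0_ideal0.
by move=> _ [b _ <-]; exact: rnorm_ge0 (a + b).
Qed.

Lemma norm_on_le (U : set X) a b : C0_ideal U b -> norm_on (~` U) a <= rnorm (a - b).
Proof.
move=> Ub; rewrite /norm_on setCK; apply: ge_inf.
  by exists 0 => _ [d _ <-]; exact: rnorm_ge0 (a + d).
by exists (- b) => //; exact: C0_idealN.
Qed.

End Localization.

(** * Asymptotic linearity and contractivity *)

Section AsymptoticEstimates.
Variables (R : realType) (A B : cstarAlgType R) (phi : A -> R -> B).
Hypothesis phi_asym : asymptotic_morphism phi.
Implicit Types a b : A.

Lemma asymptotic_near_add a b (e : R) : 0 < e ->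
  \forall t \near +oo, rnorm (phi (a + b) t - (phi a t + phi b t)) < e.
Proof. by have [_ /cvg0_rnormP] := asymptoticD phi_asym a b; apply. Qed.

Lemma asymptotic_near_scale (z : R[i]) a (e : R) : 0 < e ->
  \forall t \near +oo, rnorm (phi (z *: a) t - z *: phi a t) < e.
Proof. by have [_ /cvg0_rnormP] := asymptoticZ phi_asym z a; apply. Qed.

Lemma asymptotic_near_sum (z : nat -> R[i]) (a : nat -> A) (m : nat) (e : R) : 0 < e ->
  \forall t \near +oo,
    rnorm (phi (\sum_(k < m) z k *: a k) t - \sum_(k < m) z k *: phi (a k) t) < e.
Proof.
elim: m e => [|m IHm] e e0.
  apply: filterS (asymptotic_near_scale 0 0 e0) => t.
  by rewrite !big_ord0 !scale0r.
have e30 : 0 < e / 3 by rewrite divr_gt0.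
apply: filterS3 (IHm _ e30) (asymptotic_near_scale (z m) (a m) e30)
  (asymptotic_near_add (\sum_(k < m) z k *: a k) (z m *: a m) e30) => t.
rewrite !big_ord_recr /=; set s := \sum_(k < m) _; set u := \sum_(k < m) _.
set p := phi (s + _) t => h1 h2 h3.
have -> : p - (u + z m *: phi (a m) t) = (phi s t - u) +
    (phi (z m *: a m) t - z m *: phi (a m) t) + (p - (phi s t + phi (z m *: a m) t)).
  by rewrite (opprD u) (addrACA (phi s t)) [RHS]addrC (addrA (p - _)) subrK.
apply: le_lt_trans (rnormD _ _) _.
have := rnormD (phi s t - u) (phi (z m *: a m) t - z m *: phi (a m) t); lra.
Qed.

Lemma asymptotic_near_le a (e : R) : 0 < e ->
  \forall t \near +oo, rnorm (phi a t) <= rnorm a + e.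
Proof.
move=> e0; apply: filterS (limsup_norm_near (asymptotic_bounded phi_asym a) e0) => t.
move/le_trans; apply; rewrite lerD2r.
exact: seminorm_le_rnorm (asymptotic_seminorm phi_asym) a.
Qed.

Lemma asymptotic_near_dist a b (e : R) : 0 < e ->
  \forall t \near +oo, rnorm (phi a t - phi b t) <= rnorm (a - b) + e.
Proof.
move=> e0; have e20 : 0 < e / 2 by rewrite divr_gt0.
apply: filterS2 (asymptotic_near_add (a - b) b e20) (asymptotic_near_le (a - b) e20) => t.
rewrite subrK => h1 h2.
have -> : phi a t - phi b t = (phi a t - (phi (a - b) t + phi b t)) + phi (a - b) t.
  by rewrite opprD addrA addrAC subrK.
by apply: le_trans (rnormD _ _) _; lra.
Qed.

End AsymptoticEstimates.

(** * Comparison of the two notions of equivariance *)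

Section Equivariance.
Variables (R : realType) (X : topologicalType) (A B : C0_algebra R X).
Variable phi : A -> R -> B.
Hypothesis phi_asym : asymptotic_morphism phi.

Definition defect (f : X -> R[i]^o) (a : A) (t : R) : B :=
  phi (C0_act f a) t - C0_act f (phi a t).

Let L (a : A) : R := limsup_norm (phi a).
Let L_sn : cstar_seminorm L := asymptotic_seminorm phi_asym.

Lemma approximately_of_asymptotically :
  asymptotically_C0_equivariant phi -> approximately_equivariant phi.
Proof.
move=> equiv U U_open _ [f [a [[f0 fU] ->]]]; rewrite -/(C0_act f a).
have [_ /cvg0_rnormP to0] := equiv a f f0.
apply/cvgrPdist_lt => e e0; apply: filterS (to0 e e0) => t; apply: le_lt_trans.
rewrite sub0r normrN ger0_norm ?norm_on_ge0//; apply: norm_on_le.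
by exists f, (phi a t).
Qed.

Hypothesis approx : approximately_equivariant phi.

Section RealFunction.
Variable f : X -> R.
Hypothesis f_C0 : C0 (realC f).

Let f_cts : continuous f.
Proof. by case: f_C0 => /continuous_realC. Qed.

Lemma near_ball_ideal (c e d : R) (a : A) : 0 < d ->
  C0_ideal [set x | `|f x - c| < e] a ->
  \forall t \near +oo,
    exists2 b : B, C0_ideal [set x | `|f x - c| < e] b & rnorm (phi a t - b) < d.
Proof.
move=> d0 aU; set U := [set x | _] in aU *.
have U_open : open U.
  have -> : U = f @^-1` ball c e.
    by apply/seteqP; split=> x; rewrite /U /ball /= distrC.
  by apply: open_comp => [x _|]; [exact: f_cts | exact: ball_open].
have /cvgrPdist_lt/(_ d d0) := approx U_open aU; apply: filterS => t.
by rewrite sub0r normrN ger0_norm ?norm_on_ge0// => /norm_on_lt.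
Qed.

(** At a large time [t] each [phi_t(a_k)] is replaced by an element [b_k] of the
    ideal of [B] over the same open set, where almost orthogonality applies; the
    cost of the replacement is controlled because [m] is fixed while [t] grows. *)
Lemma near_sum_fcalc_sub_le (n c q d : R) (m : nat) (a : nat -> A) : 0 < n -> 0 < d ->
  (forall k, (k < m)%N -> C0_ideal [set x | `|f x - node n c k| < n^-1] (a k)) ->
  (forall k, (k < m)%N -> L (a k) <= q) ->
  \forall t \near +oo,
    rnorm (\sum_(k < m) fcalc f (fun s => s - node n c k) (phi (a k) t)) <=
    Num.sqrt (3 * m%:R * ((q + 2) / n) ^+ 2) + d.
Proof.
move=> n0 d0 a_ideal a_le.
have [M M0 fM] := @C0_act_bounded R X B _ f_C0.
(* [W] bounds the sum of the operator norms of the multiplications by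
   [f - node n c k], so replacing each [phi (a k) t] by an element at distance
   less than [r] costs at most [W * r <= d]. *)
pose W := \sum_(k < m) (M + `|node n c k|).
have W0 : 0 <= W by apply: sumr_ge0 => k _; rewrite addr_ge0.
have W1 : 0 < W + 1 by rewrite ltr_wpDl.
pose r := Num.min 1 (d / (W + 1)).
have r0 : 0 < r by rewrite lt_min ltr01 divr_gt0.
have r1 : r <= 1 by rewrite ge_min lexx.
have rW : W * r <= d.
  apply: (le_trans (y := (W + 1) * r)); first by rewrite ler_wpM2r ?ltW// ltrDl.
  by rewrite mulrC -ler_pdivlMr// ge_min lexx orbT.
have near_all : \forall t \near +oo, forall k : 'I_m,
    (exists2 b : B, C0_ideal [set x | `|f x - node n c k| < n^-1] b &
                   rnorm (phi (a k) t - b) < r) /\ rnorm (phi (a k) t) <= q + 1.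
  apply: filter_forall => k; apply: filterS2 (near_ball_ideal r0 (a_ideal k (ltn_ord k)))
    (limsup_norm_near (asymptotic_bounded phi_asym (a k)) ltr01) => t ? le1; split=> //.
  by apply: le_trans le1 _; rewrite lerD2r; exact: a_le.
apply: filterS near_all => t near_t.
have /choice[b bP] : forall k, exists b : B, (k < m)%N ->
    [/\ C0_ideal [set x | `|f x - node n c k| < n^-1] b,
        rnorm (phi (a k) t - b) < r & rnorm (phi (a k) t) <= q + 1].
  move=> k.
  have [km|] := ltnP k m; last by exists 0.
  by have [[b ? ?] ?] := near_t (Ordinal km); exists b.
have -> : \sum_(k < m) fcalc f (fun s => s - node n c k) (phi (a k) t) =
    \sum_(k < m) fcalc f (fun s => s - node n c k) (b k) +
    \sum_(k < m) fcalc f (fun s => s - node n c k) (phi (a k) t - b k).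
  rewrite -big_split; apply: eq_bigr => k _ /=.
  rewrite (fcalcBr f_C0 _ _ (continuous_sub_cst (c := _))).
  by rewrite [RHS]addrC subrK.
apply: le_trans (rnormD _ _) _; apply: lerD.
  rewrite -[leLHS]ger0_norm ?rnorm_ge0// -sqrtr_sqr ler_wsqrtr//.
  apply: rnorm_sum_fcalc_sub_le => // k km; first by case: (bP k km).
  have [_ br ar] := bP k km; rewrite -[b k](subKr (phi (a k) t)).
  by apply: le_trans (rnormB _ _) _; lra.
apply: le_trans (rnorm_sum _ _ _) _; apply: le_trans rW.
rewrite /W mulr_suml; apply: ler_sum => k _; rewrite fcalc_sub//.
apply: le_trans (rnormB _ _) _; rewrite mulrDl rnormZr.
have [_ /ltW br _] := bP k (ltn_ord k).
apply: lerD; last by rewrite ler_wpM2l.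
by apply: le_trans (fM _) _; rewrite ler_wpM2l.
Qed.


(** With [2 N n + 1] nodes, the squared bound on the almost orthogonal sum is of
    order [1/n]: the number of terms grows like [n] and each contributes
    [1/n^2]. *)
Lemma fine_subdivision_exists (N : nat) (l e : R) : 0 <= l -> 0 < e ->
  exists n : nat, [/\ 0 < n%:R :> R, n%:R^-1 * l <= e &
    Num.sqrt (3 * (2 * N * n).+1%:R * ((l + 2) / n%:R) ^+ 2) <= e].
Proof.
move=> l0 e0; set K := 3 * (2 * N%:R + 1) * (l + 2) ^+ 2.
have K0 : 0 <= K by rewrite mulr_ge0 ?sqr_ge0// mulr_ge0// addr_ge0// mulr_ge0.
pose z := K / e ^+ 2 + l / e.
have [K'0 l'0] : 0 <= K / e ^+ 2 /\ 0 <= l / e.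
  by split; rewrite divr_ge0// ?sqr_ge0// ltW.
exists (Num.truncn z).+1; set n := (Num.truncn z).+1.
have zn : z < n%:R by exact: truncnS_gt.
have n0 : 0 < n%:R :> R by rewrite ltr0n.
have Kn : K <= e ^+ 2 * n%:R by rewrite -ler_pdivrMl ?exprn_gt0// mulrC /z in zn *; lra.
have ln : l <= e * n%:R by rewrite -ler_pdivrMl// mulrC /z in zn *; lra.
split=> //; first by rewrite ler_pdivrMl// mulrC.
have n1 : 1 <= n%:R :> R by rewrite ler1n.
have m_le : (2 * N * n).+1%:R <= (2 * N%:R + 1) * n%:R :> R.
  by rewrite -natr1 !natrM; lra.
rewrite -[leRHS]ger0_norm ?(ltW e0)// -sqrtr_sqr ler_wsqrtr//.
rewrite expr_div_n mulrA ler_pdivrMr ?exprn_gt0//.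
apply: (le_trans (y := K * n%:R)).
  rewrite /K [leRHS]mulrAC ler_wpM2r ?sqr_ge0// -mulrA.
  by rewrite ler_wpM2l.
by rewrite [n%:R ^+ 2]expr2 mulrA ler_wpM2r// ltW.
Qed.

(** The main estimate.  The defect splits into three errors of additivity, the
    term [phi_t(f a - sum l_k a_k)], which is small because the argument is,
    and the almost orthogonal sum of the [(f - l_k) phi_t(a_k)]. *)
Lemma near_defect_nondegenerate (h : X -> R[i]^o) (a0 : A) (e : R) : C0 h -> 0 < e ->
  \forall t \near +oo, rnorm (defect (realC f) (C0_act h a0) t) <= 7 * e.
Proof.
move=> h_C0 e0; set a := C0_act h a0.
have [N f_le] := C0_real_bounded f_C0.
have l0 : 0 <= L a := seminorm_ge0 L_sn a.
have [n [n0 n_small sqrt_small]] := fine_subdivision_exists N l0 e0.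
set m := (2 * N * n).+1 in sqrt_small.
set nr := n%:R in n0 n_small sqrt_small; set c : R := N%:R.
(* the bound [N] on [|f|] makes the nodes [k / n - N], for [k <= 2 N n], cover
   the range of [f] *)
have hat_cts k : continuous (hat nr c k) by exact: continuous_hat.
pose a_ k := fcalc f (hat nr c k) a.
have a_ideal k : C0_ideal [set x | `|f x - node nr c k| < nr^-1] (a_ k).
  apply: fcalc_C0_act_ideal => // x; apply: contra_notP => /eqP.
  exact: hat_support.
have a_le k : L (a_ k) <= L a.
  by apply: seminorm_fcalc_le => // s; rewrite ger0_norm ?hat_ge0 ?hat_le1.
have sum_a : \sum_(k < m) a_ k = a.
  rewrite -fcalc_sum// -[RHS]scale1r -(fcalc_cst f 1 a).
  have hat1 s : `|s| <= c -> (\sum_(k < m) hat nr c k) s = 1.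
    move=> /ler_normlP[s1 s2]; rewrite fct_sumE; apply: sum_hat_eq1 => //; first by lra.
    rewrite /m -natr1 lerD2r natrM natrM -/nr -/c mulrC ler_pM2r//; lra.
  by apply: fcalc_ext => [x|]; rewrite hat1// normr0.
pose node_a := \sum_(k < m) (node nr c k)%:C *: a_ k.
pose rest := C0_act (realC f) a - node_a.
have rest_le : L rest <= e.
  pose G := \sum_(k < m) ((fun s => s - node nr c k) * hat nr c k).
  have part_cts k : continuous ((fun s => s - node nr c k) * hat nr c k).
    by move=> s; apply: cvgM; [exact: continuous_sub_cst | exact: hat_cts].
  have -> : rest = fcalc f G a.
    rewrite (fcalc_sum f_C0 _ _ part_cts) /rest /node_a -[in C0_act _ a]sum_a.
    rewrite C0_act_sumr// -sumrB.
    apply: eq_bigr => k _; rewrite -fcalc_sub// fcalcM//; exact: continuous_sub_cst.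
  apply: le_trans n_small; apply: (seminorm_fcalc_le_scale f_C0 _ L_sn).
  - move=> s; rewrite /G; elim: (m) => [|j IHj].
      by rewrite big_ord0; exact: cvg_cst.
    by rewrite big_ord_recr; apply: cvgD; [exact: IHj | exact: part_cts].
  - by rewrite invr_gt0.
  - by move=> s; rewrite /G fct_sumE; exact: sum_hat_dist.
have [M M0 fM] := @C0_act_bounded R X B _ f_C0.
have M1 : 0 < M + 1 by rewrite ltr_wpDl.
have e'0 : 0 < e / (M + 1) by rewrite divr_gt0.
have near_S := near_sum_fcalc_sub_le n0 e0 (fun k (_ : (k < m)%N) => a_ideal k)
  (fun k _ => a_le k).
have near_a := asymptotic_near_sum phi_asym (fun=> 1) a_ m e'0.
have near_node := asymptotic_near_sum phi_asym (fun k => (node nr c k)%:C) a_ m e0.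
apply: filterS3 near_S near_a (filterI near_node (filterI
  (asymptotic_near_add phi_asym rest node_a e0)
  (limsup_norm_near (asymptotic_bounded phi_asym rest) e0))) => t.
set S := \sum_(k < m) _.
pose u := \sum_(k < m) phi (a_ k) t.
pose v := \sum_(k < m) (node nr c k)%:C *: phi (a_ k) t.
have -> : \sum_(k < m) 1 *: a_ k = a.
  by rewrite -sum_a; apply: eq_bigr => k _; rewrite scale1r.
have -> : \sum_(k < m) 1 *: phi (a_ k) t = u by apply: eq_bigr => k _; rewrite scale1r.
move=> S_le a_near [node_near [add_near rest_near]].
have SE : S = C0_act (realC f) u - v.
  by rewrite C0_act_sumr// -sumrB; apply: eq_bigr => k _; rewrite fcalc_sub.
have -> : defect (realC f) a t =
    (phi (C0_act (realC f) a) t - (phi rest t + phi node_a t)) + phi rest t +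
    (phi node_a t - v) - C0_act (realC f) (phi a t - u) - S.
  rewrite /defect SE C0_actBr// -/a.
  set F1 := phi (C0_act _ _) t; set F2 := C0_act _ (phi a t); set F3 := C0_act _ u.
  rewrite (opprD (phi rest t)) (addrA F1) (addrAC F1) subrK.
  rewrite (addrA (F1 - _)) subrK -(addrA (F1 - v)) -opprD (addrA (F2 - F3)) subrK.
  by rewrite opprB addrA subrK.
have f_near : rnorm (C0_act (realC f) (phi a t - u)) <= e.
  apply: le_trans (fM _) _; apply: (le_trans (y := (M + 1) * (e / (M + 1)))).
    by apply: ler_pM; rewrite ?rnorm_ge0// ?lerDl// ltW.
  by rewrite mulrC divfK ?lt0r_neq0.
have -> : 7 * e = e + (e + e) + e + e + (e + e) by ring.
apply: le_trans (rnormB _ _) _; apply: lerD; last first.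
  by apply: le_trans S_le _; rewrite lerD2r.
apply: le_trans (rnormB _ _) _; apply: lerD => //.
apply: le_trans (rnormD _ _) _; apply: lerD; last exact: ltW.
apply: le_trans (rnormD _ _) _; apply: lerD.
  by move: add_near; rewrite subrK => /ltW.
by apply: le_trans rest_near _; rewrite lerD2r.
Qed.


(** Density of the range of the action gives all of [A], since both sides of
    the defect depend on [a] in an asymptotically Lipschitz way. *)
Lemma near_defect_real (a : A) (e : R) : 0 < e ->
  \forall t \near +oo, rnorm (defect (realC f) a t) <= e.
Proof.
move=> e0.
have [M M0 fM] := @C0_act_bounded R X A _ f_C0.
have [M' M'0 fM'] := @C0_act_bounded R X B _ f_C0.
have c0 : 0 < 4 * (M + M' + 1) by rewrite mulr_gt0// ltr_wpDl// addr_ge0.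
set d := e / (4 * (M + M' + 1)); have d0 : 0 < d by rewrite divr_gt0.
have dE : d * (4 * (M + M' + 1)) = e by rewrite divfK ?lt0r_neq0.
have [a' [aa' [h [a0 [[h_C0 _] a'E]]]]] : (ball a d%:C `&` C0_ideal setT) !=set0.
  apply: (C0_structure_nondegenerate (C0_structureP A)).
    by exists a; apply: ballxx; rewrite ltcR.
  by apply: ball_open; rewrite ltcR.
have {}aa' : rnorm (a - a') <= d.
  by move: aa'; rewrite -ball_normE /= rnormE ltcR => /ltW.
have e28 : 0 < e / 28 by rewrite divr_gt0.
have e4 : 0 < e / 4 by rewrite divr_gt0.
have near_a' := near_defect_nondegenerate a0 h_C0 e28.
apply: filterS3 near_a' (asymptotic_near_dist phi_asym (C0_act (realC f) a)
  (C0_act (realC f) a') e4) (asymptotic_near_dist phi_asym a a' d0) => t.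
rewrite -/(C0_act h a0) in a'E; rewrite -a'E -C0_actBr// => h1 h2 h3.
have -> : defect (realC f) a t = defect (realC f) a' t +
    (phi (C0_act (realC f) a) t - phi (C0_act (realC f) a') t) -
    C0_act (realC f) (phi a t - phi a' t).
  rewrite /defect C0_actBr//.
  set F1 := phi (C0_act _ a) t; set F2 := phi (C0_act _ a') t.
  rewrite [_ - _ + (F1 - F2)]addrC addrA subrK opprB addrA.
  by rewrite subrK.
apply: le_trans (rnormB _ _) _; have := rnormD (defect (realC f) a' t)
  (phi (C0_act (realC f) a) t - phi (C0_act (realC f) a') t).
have h4 := le_trans (fM (a - a')) (ler_wpM2l M0 aa').
have h5 := le_trans (fM' _) (ler_wpM2l M'0 (le_trans h3 (lerD aa' (lexx d)))).
have Md := mulr_ge0 M0 (ltW d0); have M'd := mulr_ge0 M'0 (ltW d0).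
lra.
Qed.

End RealFunction.

Lemma near_defect (f : X -> R[i]^o) (a : A) (e : R) : C0 f -> 0 < e ->
  \forall t \near +oo, rnorm (defect f a t) < e.
Proof.
move=> f_C0 e0.
pose f1 x := complex.Re (f x); pose f2 x := complex.Re (- 'i * f x).
have f1_C0 : C0 (realC f1) by exact: C0_re.
have f2_C0 : C0 (realC f2) by apply: (@C0_re _ _ (- 'i *: f)); exact: C0_scale.
have fE : f = realC f1 + 'i *: realC f2.
  apply/funext => x; rewrite !fctE /realC /f1 /f2 [LHS]complexE.
  congr (_ + 'i%C * _%:C); case: (f x) => u v /=; ring.
have f_act (D : C0_algebra R X) (d : D) :
    C0_act f d = C0_act (realC f1) d + 'i *: C0_act (realC f2) d.
  by rewrite fE C0_actDl ?C0_actZl//; exact: C0_scale.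
have e5 : 0 < e / 5 by rewrite divr_gt0.
apply: filterS3 (asymptotic_near_add phi_asym (C0_act (realC f1) a)
    ('i *: C0_act (realC f2) a) e5)
  (asymptotic_near_scale phi_asym 'i (C0_act (realC f2) a) e5)
  (filterI (near_defect_real f1_C0 a e5) (near_defect_real f2_C0 a e5)).
move=> t h1 h2 [h3 h4].
have -> : defect f a t = (phi (C0_act f a) t - (phi (C0_act (realC f1) a) t +
      phi ('i *: C0_act (realC f2) a) t)) +
    (phi ('i *: C0_act (realC f2) a) t - 'i *: phi (C0_act (realC f2) a) t) +
    defect (realC f1) a t + 'i *: defect (realC f2) a t.
  rewrite /defect f_act [in LHS]f_act scalerBr.
  set F := phi (_ + _) t; set G := phi (C0_act (realC f1) a) t.
  set H := phi ('i *: _) t; set K := 'i *: phi (C0_act (realC f2) a) t.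
  rewrite (opprD G) (addrA F) (addrA (F - G - H)) subrK.
  rewrite (addrAC (F - G) (- K)) (addrA (F - G)) subrK.
  by rewrite [RHS]addrA subrK opprD addrA.
rewrite -f_act in h1.
apply: le_lt_trans (rnormD _ _) _.
have : rnorm ('i *: defect (realC f2) a t) <= e / 5.
  by rewrite rnormZ normCi mul1r.
set D1 := phi (C0_act f a) t - _ in h1 *.
set D2 := phi _ t - _ in h2 *.
have := rnormD (D1 + D2) (defect (realC f1) a t); have := rnormD D1 D2.
lra.
Qed.

Lemma asymptotically_of_approximately : asymptotically_C0_equivariant phi.
Proof.
move=> a f f_C0; split; last first.
  by apply/cvg0_rnormP => e e0; exact: near_defect.
have [fa_cts _] := asymptotic_Cb phi_asym (C0_act f a).
have [a_cts _] := asymptotic_Cb phi_asym a.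
have [M M0 fM] := @C0_act_bounded R X B _ f_C0.
have M1 : 0 < M + 1 by rewrite ltr_wpDl.
move=> t; apply: cvgB; first exact: fa_cts.
apply/cvg_rnormP => e e0; have e'0 : 0 < e / (M + 1) by rewrite divr_gt0.
have /cvg_rnormP/(_ _ e'0) := a_cts t; apply: filterS => s; rewrite -C0_actBr//.
rewrite ltr_pdivlMr// mulrC => /(le_lt_trans _); apply.
by apply: le_trans (fM _) _; rewrite ler_wpM2r ?rnorm_ge0// lerDl.
Qed.

End Equivariance.

Theorem proposition2p11 (R : realType) (X : topologicalType)
    (X_hausdorff : hausdorff_space X)
    (X_locally_compact : locally_compact [set: X])
    (X_second_countable : @second_countable X)
    (A B : C0_algebra R X)
    (phi : A -> R -> B) (phi_asymptotic : asymptotic_morphism phi) :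
  asymptotically_C0_equivariant phi <-> approximately_equivariant phi.
Proof.
by split; [exact: approximately_of_asymptotically |
           exact: asymptotically_of_approximately].
Qed.
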